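(* Let $g:[-1,1]\to\mathbb{R}$ be continuously differentiable and let $\psi:\mathcal{M}_+\to\mathbb{R}$ satisfy: (H2) $|\psi(\mu)-\psi(\nu)|\le \|\psi\|_{\mathrm{Lip},\mathrm{TV}}\,\mathrm{TV}(\mu,\nu)$ for all $\mu,\nu\in\mathcal{M}_+$; (H3') there exists $a>0$ such that for every integer $K\ge1$, $\nabla\psi^{(K)}\in L^\infty(\mathbb{R}_{\ge0}^{D_K};\mathcal{K}_{=a,K}')$; (H4) there is a constant $\|\psi\|_{\mathrm{Lip},W}<\infty$ with $|\psi(\mathbb{P})-\psi(\mathbb{Q})|\le\|\psi\|_{\mathrm{Lip},W}W(\mathbb{P},\mathbb{Q})$ for all probability measures $\mathbb{P},\mathbb{Q}$ on $[-1,1]$. Suppose that there exists $b\in\mathbb{R}$ such that the translated kernel $\widetilde g_b(z)=g(z)+b$ is strictly positive on $[-1,1]$ and satisfies $\int_{-1}^1\int_{-1}^1\widetilde g_b(xy)\,d\mu(x)\,d\mu(y)\ge0$ for every finite signed measure $\mu$ on $[-1,1]$. Suppose moreover that for every $\mu\in\mathcal{M}_+$, $\psi$ admits a Gateaux derivative at $\mu$ with density $x\mapsto D_\mu\psi(\mu,x)$ belonging to $\mathcal{C}_{a,\infty}=\{G_\eta:\eta\in\mathcal{M}_{a,+}\}$, with $a$ as in (H3'). Let $f:[0,\infty)\times\mathcal{M}_+\to\mathbb{R}$ be the solution to the infinite-dimensional Hamilton-Jacobi equation with kernel $g$ and initial condition $\psi$ (as defined in the context). Then for every $t>0$ and $\mu\in\mathcal{M}_+$,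 $$f(t,\mu)=\sup_{\nu\in\mathcal{M}_{a,+}}\Big\{\psi(\mu+t\nu)-\frac t2\int_{-1}^1G_\nu(y)\,d\nu(y)\Big\}.$$ Moreover, this supremum is achieved at some $\nu^*\in\mathcal{M}_{a,+}$ with $G_{\nu^*}=D_\mu\psi(\mu+t\nu^*,\cdot)$.
   Context: $\mathcal{M}_+$ is the set of finite non-negative measures on $[-1,1]$; $\mathcal{M}_{a,+}=\{\mu\in\mathcal{M}_+:\mu[-1,1]=a\}$; $G_\mu(x)=\int_{-1}^1g(xy)\,d\mu(y)$. $\mathrm{TV}(\mu,\nu)=\sup_A|\mu(A)-\nu(A)|$ over measurable $A\subset[-1,1]$, and $W(\mathbb{P},\mathbb{Q})=\sup\{|\int h\,d\mathbb{P}-\int h\,d\mathbb{Q}|: h:[-1,1]\to\mathbb{R}\text{ 1-Lipschitz}\}$. For $\varphi:\mathcal{M}_+\to\mathbb{R}$, $\|\varphi\|_{\mathrm{Lip},\mathrm{TV}}$ denotes its Lipschitz constant with respect to $\mathrm{TV}$. Gateaux derivative: $D_\mu\psi(\mu;\nu)=\lim_{\epsilon\to0}\frac{\psi(\mu+\epsilon\nu)-\psi(\mu)}{\epsilon}$ (over those $\epsilon\ne0$ with $\mu+\epsilon\nu\in\mathcal{M}_+$). It admits a density at $\mu$ if there is a bounded measurable function $x\mapsto D_\mu\psi(\mu,x)$ on $[-1,1]$ with $D_\mu\psi(\mu;\nu)=\int_{-1}^1D_\mu\psi(\mu,x)\,d\nu(x)$ for every $\nu\in\mathcal{M}_+$.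 For an integer $K\ge1$, $D_K=\{i/2^K: i\in\mathbb{Z},\ -2^K\le i<2^K\}$, so $|D_K|=2^{K+1}$; vectors in $\mathbb{R}^{D_K}$ are indexed by $D_K$. For $x\in\mathbb{R}_{\ge0}^{D_K}$ let $\mu_x^{(K)}=\frac1{|D_K|}\sum_{k\in D_K}x_k\delta_k$; for $\varphi:\mathcal{M}_+\to\mathbb{R}$, $\varphi^{(K)}(x)=\varphi(\mu_x^{(K)})$. For $\mu\in\mathcal{M}_+$, $x^{(K)}(\mu)=(|D_K|\,\mu(I_k))_{k\in D_K}$, where $I_k=[k,k+2^{-K})$ for $k\neq 1-2^{-K}$ and $I_{1-2^{-K}}=[1-2^{-K},1]$. Normalized norms on $\mathbb{R}^d$ (with $d=|D_K|$ for $\mathbb{R}^{D_K}$): $\|x\|_1=\frac1d\sum_k|x_k|$ and $\|y\|_{1,*}=\max_k d|y_k|$. For $h:\mathbb{R}_{\ge0}^d\to\mathbb{R}$, $\|h\|_{\mathrm{Lip},1}=\sup_{x\ne x'}|h(x)-h(x')|/\|x-x'\|_1$. Inequalities between vectors are coordinatewise. With $G^{(K)}=|D_K|^{-2}(g(kk'))_{k,k'\in D_K}$: $\mathcal{K}_{=a,K}=\{G^{(K)}x: x\in\mathbb{R}_{\ge0}^{D_K},\ \|x\|_1=a\}$ and $\mathcal{K}_{=a,K}'=\{y+w: y\in\mathcal{K}_{=a,K},\ \|w\|_{1,*}\le|D_K|^{-1/2}\}$. (H3') means that the a.e. defined gradient of the Lipschitz function $\psi^{(K)}$ lies in $\mathcal{K}_{=a,K}'$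 almost everywhere. Solution for a positive kernel. Let $q:[-1,1]\to\mathbb{R}$ be a continuously differentiable kernel with $q\ge m>0$ and $\varphi:\mathcal{M}_+\to\mathbb{R}$ an initial condition. Put $Q^{(K)}=|D_K|^{-2}(q(kk'))_{k,k'\in D_K}$, $\mathcal{C}_K=\{Q^{(K)}x: x\in\mathbb{R}_{\ge0}^{D_K}\}$, $\mathsf{C}_K(Q^{(K)}x)=\frac12Q^{(K)}x\cdot x$ (well-defined on $\mathcal{C}_K$). For $R>0$ define $\widetilde{\mathsf C}_{K,R}:\mathcal{C}_K\to\mathbb{R}$ by $\widetilde{\mathsf C}_{K,R}(y)=\max\big(\mathsf{C}_K(y),\frac{8R}{m}(\|y\|_{1,*}-R)\big)$ if $\|y\|_{1,*}\le2R$ and $\widetilde{\mathsf C}_{K,R}(y)=\frac{8R}{m}(\|y\|_{1,*}-R)$ otherwise, and $\mathsf{H}_{K,R}(y)=\inf\{\widetilde{\mathsf C}_{K,R}(w): w\in\mathcal{C}_K,\ w\ge y\}$ for $y\in\mathbb{R}^{D_K}$. Let $f_R^{(K)}\in\mathfrak{L}_{\mathrm{unif}}$ be the unique viscosity solution of $\partial_tf=\mathsf{H}_{K,R}(\nabla f)$ on $\mathbb{R}_{>0}\times\mathbb{R}_{>0}^{D_K}$ with $f(0,\cdot)=\varphi^{(K)}$. The solution to the infinite-dimensional Hamilton-Jacobi equation with kernel $q$ and initial condition $\varphi$ is $\lim_{K\to\infty}f_R^{(K)}(t,x^{(K)}(\mu))$ for any $R>\|\varphi\|_{\mathrm{Lip},\mathrm{TV}}$.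 Existence and uniqueness of $f_R^{(K)}$, and existence, finiteness and $R$-independence of the limit, hold for $q=\widetilde g_b$, $\varphi=\widetilde\psi_b$ below, under (H2), (H3'), (H4). Solution for a general kernel $g$. For $b\in\mathbb{R}$ with $\widetilde g_b=g+b$ positive on $[-1,1]$, let $\widetilde\psi_b(\mu)=\psi(\mu)+ab\,\mu[-1,1]$, let $\widetilde f_b$ be the solution with kernel $\widetilde g_b$ and initial condition $\widetilde\psi_b$, and put $f(t,\mu)=\widetilde f_b(t,\mu)-ab\,\mu[-1,1]-\frac{a^2bt}{2}$. Under (H2), (H3'), (H4) this does not depend on the choice of such $b$; it is by definition the solution with kernel $g$ and initial condition $\psi$. Function spaces: for $u:[0,\infty)\times\mathbb{R}_{\ge0}^d\to\mathbb{R}$, $[u]_0=\sup_{t>0,x}|u(t,x)-u(0,x)|/t$; $\mathfrak{L}$ is the set of such $u$ with $u(0,\cdot)$ Lipschitz and $[u]_0<\infty$; $\mathfrak{L}_{\mathrm{unif}}=\{u\in\mathfrak{L}:\sup_{t\ge0}\|u(t,\cdot)\|_{\mathrm{Lip},1}<\infty\}$. Viscosity solutions: a continuous function $f$ is a viscosity solution of $\partial_tf=\mathsf{H}(\nabla f)$ on $\mathbb{R}_{>0}\times\mathbb{R}_{>0}^d$ if for every $\phi\in C^\infty((0,\infty)\times\mathbb{R}_{>0}^d)$ and $(t^*,x^* )\in(0,\infty)\times\mathbb{R}_{>0}^d$: $(\partial_t\phi-\mathsf{H}(\nabla\phi))(t^*,x^* )\le0$ whenever $f-\phi$ has a local maximum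 at $(t^*,x^* )$, and $\ge0$ whenever $f-\phi$ has a local minimum there. *)

(* Defs.v *)
From HB Require Import structures.
From mathcomp Require Import all_boot all_order all_algebra.
From mathcomp Require Import all_classical all_reals all_analysis.

Set Implicit Arguments.
Unset Strict Implicit.
Unset Printing Implicit Defensive.

Import Order.TTheory GRing.Theory Num.Theory.
Import numFieldNormedType.Exports.

Local Open Scope classical_set_scope.
Local Open Scope ring_scope.

(* A function on [-1, 1] is a function on R whose values outside [-1, 1] are
   ignored; likewise below for functions on [0, oo) x R_{>=0}^d. *)
Definition I11 {R : realType} : set R := `[-1, 1]%classic.

Section measures.
Context {R : realType}.
Local Notation RM := (measurableTypeR R).

(* Finite measures on [-1, 1] are represented by the finite measures on R that
   vanish outside [-1, 1].  A measure of the library also has (irrelevant)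
   values on non-measurable sets; two measures that agree on the measurable
   sets are at TV-distance 0, so a TV-Lipschitz functional does not see these
   values. *)
Record Mplus := MkMplus {
  Mplus_measure :> {finite_measure set RM -> \bar R} ;
  Mplus_supp : Mplus_measure (~` I11) = 0%E }.

Definition mass (mu : Mplus) : R := fine (mu I11).

Section packing.
Context (m : {measure set RM -> \bar R}) (mfin : fin_num_fun m).

Definition fin_measure_of : set RM -> \bar R := m.
HB.instance Definition _ := Measure.on fin_measure_of.
Let fin_measure_of_fin : fin_num_fun fin_measure_of. Proof. exact: mfin. Qed.
HB.instance Definition _ :=
  @Measure_isFinite.Build _ RM R fin_measure_of fin_measure_of_fin.
Definition pack_fin_measure : {finite_measure set RM -> \bar R} :=
  fin_measure_of.
End packing.

Section translate.
Context (mu : Mplus) (t : {nonneg R}) (nu : Mplus).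

Let m : {measure set RM -> \bar R} := measure_add mu (mscale t nu).

Let mE A : m A = (mu A + t%:num%:E * nu A)%E.
Proof. exact: measure_addE. Qed.

Let m_fin : fin_num_fun m.
Proof. by move=> A mA; rewrite mE fin_numD fin_numM// !fin_num_measure. Qed.

Let m_supp : pack_fin_measure m_fin (~` I11) = 0%E.
Proof. by rewrite [LHS]mE !Mplus_supp mule0 adde0. Qed.

(* mu + t nu *)
Definition translate : Mplus := MkMplus m_supp.

Lemma translateE A : translate A = (mu A + t%:num%:E * nu A)%E.
Proof. exact: mE. Qed.
End translate.

Definition TV (mu nu : Mplus) : R :=
  sup [set `|fine (mu A) - fine (nu A)| |
       A in [set A : set RM | measurable A /\ A `<=` I11]].

Definition lipschitz_TV (phi : Mplus -> R) (L : R) :=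
  forall mu nu : Mplus, `|phi mu - phi nu| <= L * TV mu nu.

(* the Lipschitz constant; +oo if phi is not Lipschitz *)
Definition Lip_TV (phi : Mplus -> R) : \bar R :=
  ereal_inf [set L%:E | L in [set L | lipschitz_TV phi L]].

Definition W (P Q : Mplus) : R :=
  sup [set `|\int[P]_(x in I11) h x - \int[Q]_(x in I11) h x| |
       h in [set h : R -> R | 1.-lipschitz_I11 h]].

Definition lipschitz_W (phi : Mplus -> R) (L : R) :=
  forall P Q : Mplus, mass P = 1 -> mass Q = 1 ->
    `|phi P - phi Q| <= L * W P Q.

Definition Gfun (g : R -> R) (mu : Mplus) (x : R) : R :=
  \int[mu]_(y in I11) g (x * y).

(* epsilon may be negative, as long as mu + epsilon nu is a non-negative
   measure. *)
Definition gateaux (psi : Mplus -> R) (mu nu : Mplus) (l : R) : Prop :=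
  forall e : R, 0 < e -> \forall eps \near (0 : R)^', forall rho : Mplus,
    (forall A : set RM, measurable A -> rho A = mu A + eps%:E * nu A)%E ->
    `|(psi rho - psi mu) / eps - l| < e.

Definition gateaux_density (psi : Mplus -> R) (mu : Mplus) (D : R -> R) :=
  [/\ measurable_fun (I11 : set RM) (D : RM -> R),
      exists M : R, forall x, x \in I11 -> `|D x| <= M &
      forall nu : Mplus, gateaux psi mu nu (\int[nu]_(x in I11) D x)].

Definition in_Cinfty (g : R -> R) (a : R) (h : R -> R) : Prop :=
  exists2 eta : Mplus, mass eta = a &
    forall x, x \in I11 -> h x = Gfun g eta x.

(* derivatives at the endpoints are one-sided *)
Definition C1_on_I11 (g : R -> R) : Prop :=
  exists2 g' : R -> R, {within I11, continuous g'} &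
    forall x, x \in I11 ->
      (g y - g x) / (y - x) @[y --> within I11 x^'] --> g' x.

Definition charge_int (mu : {charge set RM -> \bar R}) (P N : set RM)
    (muPN : hahn_decomposition mu P N) (h : R -> R) : R :=
  \int[jordan_pos muPN]_(x in I11) h x - \int[jordan_neg muPN]_(x in I11) h x.

(* All Hahn decompositions of mu give the same integrals. *)
Definition psd_kernel (q : R -> R) : Prop :=
  forall mu : {charge set RM -> \bar R},
    (forall A, measurable A -> A `<=` ~` I11 -> mu A = 0%E) ->
    forall P N (muPN : hahn_decomposition mu P N),
      0 <= charge_int muPN (fun y => charge_int muPN (fun x => q (x * y))).

End measures.
Arguments Mplus : clear implicits.

Section euclidean.
Context {R : realType} {d : nat}.
Local Notation V := 'cV[R]_d.

Definition nonneg (x : V) : Prop := forall k, 0 <= x k 0.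
Definition pos (x : V) : Prop := forall k, 0 < x k 0.

Definition dot (x y : V) : R := \sum_k x k 0 * y k 0.
Definition norm1 (x : V) : R := d%:R^-1 * \sum_k `|x k 0|.
Definition norm1s (y : V) : R := \big[Num.max/0]_k (d%:R * `|y k 0|).

Definition Lip1 (h : V -> R) : \bar R :=
  ereal_sup [set z | exists x x', [/\ nonneg x, nonneg x', x <> x' &
                     z = (`|h x - h x'| / norm1 (x - x'))%:E]].

(* Lebesgue outer measure *)
Definition lebesgue_outer (A : set V) : \bar R :=
  ereal_inf [set z | exists a b : nat -> V,
    [/\ forall n k, a n k 0 <= b n k 0,
        A `<=` \bigcup_n [set x | forall k, a n k 0 <= x k 0 <= b n k 0] &
        z = (\sum_(0 <= n <oo) (\prod_k (b n k 0 - a n k 0))%:E)%E]].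

Definition gradient (h : V -> R) (x : V) : V :=
  \col_k 'D_(delta_mx k 0 : V) h x.

(* C^n on the open set U, through iterated directional derivatives *)
Fixpoint Cn (E : normedModType R) (U : set E) (n : nat) (h : E -> R) : Prop :=
  (forall p, U p -> {for p, continuous h}) /\
  if n is n'.+1 then
    forall v : E, (forall p, U p -> derivable h p v) /\ Cn U n' ('D_v h)
  else True.

Definition smooth (E : normedModType R) (U : set E) (h : E -> R) : Prop :=
  forall n, Cn U n h.

Definition open_domain : set (R * V) := [set p | 0 < p.1 /\ pos p.2].
Definition domain : set (R * V) := [set p | 0 <= p.1 /\ nonneg p.2].

Definition dt (phi : R * V -> R) (p : R * V) : R := 'D_((1, 0) : R * V) phi p.
Definition dx (phi : R * V -> R) (p : R * V) : V :=
  \col_k 'D_((0, delta_mx k 0) : R * V) phi p.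

Definition viscosity_solution (H : V -> R) (u : R -> V -> R) : Prop :=
  {within domain, continuous (fun p : R * V => u p.1 p.2)} /\
  forall (phi : R * V -> R), smooth open_domain phi ->
  forall p0 : R * V, open_domain p0 ->
    ((\forall p \near p0, u p.1 p.2 - phi p <= u p0.1 p0.2 - phi p0) ->
       dt phi p0 - H (dx phi p0) <= 0) /\
    ((\forall p \near p0, u p.1 p.2 - phi p >= u p0.1 p0.2 - phi p0) ->
       dt phi p0 - H (dx phi p0) >= 0).

Definition bracket0 (u : R -> V -> R) : \bar R :=
  ereal_sup [set z | exists t x, [/\ 0 < t, nonneg x &
                     z = (`|u t x - u 0 x| / t)%:E]].

Definition Lspace (u : R -> V -> R) : Prop :=
  (Lip1 (u 0%R) < +oo)%E /\ (bracket0 u < +oo)%E.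

Definition Lunif (u : R -> V -> R) : Prop :=
  Lspace u /\ (ereal_sup [set Lip1 (u t) | t in [set t : R | (0 <= t)%R]] < +oo)%E.

Definition Lunif_solution (H : V -> R) (h : V -> R) (u : R -> V -> R) : Prop :=
  [/\ Lunif u, viscosity_solution H u & forall x, nonneg x -> u 0 x = h x].

(* u is the solution: existence and uniqueness are part of this predicate.
   Uniqueness is up to the values outside of [0, oo) x R_{>=0}^d. *)
Definition unique_solution (H h : V -> R) (u : R -> V -> R) : Prop :=
  Lunif_solution H h u /\
  forall v, Lunif_solution H h v ->
    forall t x, 0 <= t -> nonneg x -> v t x = u t x.

End euclidean.

Section dyadic.
Context {R : realType}.
Local Notation RM := (measurableTypeR R).
Context (K : nat).

(* D_K is indexed by 'I_dK, with i standing for the point -1 + i / 2^K. *)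
Local Notation dK := (2 ^ K.+1)%N.
Local Notation V := 'cV[R]_dK.

Definition dyad (i : nat) : R := i%:R / 2 ^+ K - 1.

Definition cell (i : 'I_dK) : set R :=
  if i.+1 == dK then `[dyad i, 1]%classic
  else `[dyad i, dyad i + (2 ^+ K)^-1[%classic.

Definition coords (mu : Mplus R) : V :=
  \col_i (dK%:R * fine (mu (cell i))).

Section atomic.
Context (x : V).

(* Negative coordinates are replaced by 0, so that this is a measure for every
   x; it is only meaningful for x >= 0. *)
Definition atomic_fun (A : set RM) : \bar R :=
  (\sum_(k < dK) (Num.max (x k 0) 0 / dK%:R)%:E * \d_(dyad k : RM) A)%E.

Let w_ge0 (i : 'I_dK) : 0 <= Num.max (x i 0) 0 / dK%:R.
Proof. by rewrite divr_ge0 ?ler0n// le_max lexx orbT. Qed.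

Let w (k : nat) : {nonneg R} :=
  if insub k is Some i then NngNum (w_ge0 i) else 0%:nng.

Let atomic_funE :
  atomic_fun = msum (fun k => mscale (w k) (\d_(dyad k : RM))) dK.
Proof.
apply/funext => A; rewrite /atomic_fun /msum; apply: eq_bigr => k _.
by rewrite /mscale /w valK.
Qed.

Let atomic0 : atomic_fun set0 = 0%E.
Proof. by rewrite atomic_funE measure0. Qed.
Let atomic_ge0 A : (0 <= atomic_fun A)%E.
Proof. by rewrite atomic_funE measure_ge0. Qed.
Let atomic_sigma : semi_sigma_additive atomic_fun.
Proof. by rewrite atomic_funE; exact: measure_semi_sigma_additive. Qed.

HB.instance Definition _ := isMeasure.Build _ _ _ atomic_fun
  atomic0 atomic_ge0 atomic_sigma.

Let atomic_fin : fin_num_fun atomic_fun.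
Proof.
move=> A mA; rewrite /atomic_fun; apply/sum_fin_numP => k _ _.
by rewrite diracE -EFinM.
Qed.

Let dyad_I11 (k : 'I_dK) : I11 (dyad k).
Proof.
have K0 : 0 < 2 ^+ K :> R by rewrite exprn_gt0.
rewrite /I11/= in_itv/= /dyad lerBrDr addNr divr_ge0 ?ler0n ?(ltW K0)//=.
rewrite lerBlDr ler_pdivrMr// -[1 + 1]/(2%:R) -natrX -natrM ler_nat -expnS.
exact/ltnW.
Qed.

Let atomic_supp : pack_fin_measure atomic_fin (~` I11) = 0%E.
Proof.
rewrite /pack_fin_measure/= /fin_measure_of/= /atomic_fun big1// => k _.
by rewrite diracE memNset ?mule0//=; apply; exact: dyad_I11.
Qed.

Definition atomic : Mplus R := MkMplus atomic_supp.
End atomic.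

Definition restr_fun (phi : Mplus R -> R) (x : V) : R := phi (atomic x).

Definition kmatrix (g : R -> R) : 'M[R]_dK :=
  \matrix_(i, j) (g (dyad i * dyad j) / dK%:R ^+ 2).

Definition Kset (g : R -> R) (a : R) : set V :=
  [set y | exists x, [/\ nonneg x, norm1 x = a & y = kmatrix g *m x]].

Definition Kset' (g : R -> R) (a : R) : set V :=
  [set z | exists y w, [/\ Kset g a y, norm1s w <= (Num.sqrt dK%:R)^-1 &
                          z = y + w]].

(* the a.e. defined gradient of h lies in Kset' almost everywhere *)
Definition gradient_in_Kset' (g : R -> R) (a : R) (h : V -> R) : Prop :=
  lebesgue_outer [set x | nonneg x /\
    ~ (differentiable h x /\ Kset' g a (gradient h x))] = 0%E.

Definition cone (q : R -> R) : set V :=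
  [set y | exists2 x, nonneg x & y = kmatrix q *m x].

(* The value does not depend on the choice of x, as kmatrix q is symmetric. *)
Definition Cfun (q : R -> R) (y : V) : R :=
  dot y (xget 0 [set x | nonneg x /\ y = kmatrix q *m x]) / 2.

Definition Ctilde (q : R -> R) (m r : R) (y : V) : R :=
  let l := 8 * r / m * (norm1s y - r) in
  if norm1s y <= 2 * r then Num.max (Cfun q y) l else l.

Definition Hfun (q : R -> R) (m r : R) (y : V) : R :=
  inf [set Ctilde q m r w |
       w in [set w | cone q w /\ forall k, y k 0 <= w k 0]].

End dyadic.

Section infinite_dimensional.
Context {R : realType}.

Definition HJ_solution_pos (q : R -> R) (phi : Mplus R -> R)
    (f : R -> Mplus R -> R) : Prop :=
  forall m r : R, 0 < m -> (forall z, z \in I11 -> m <= q z) ->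
    (Lip_TV phi < r%:E)%E ->
  exists u : forall K, R -> 'cV[R]_(2 ^ K.+1) -> R,
    (forall K, (0 < K)%N ->
       unique_solution (@Hfun R K q m r) (restr_fun phi) (u K)) /\
    forall (t : R) (mu : Mplus R), 0 <= t ->
      u K t (coords K mu) @[K --> \oo] --> f t mu.

(* f is the function obtained with every admissible choice of b (and, in
   HJ_solution_pos, of the lower bound m of the kernel and of the cut-off
   radius r): "the solution" presupposes that these choices do not matter. *)
Definition HJ_solution (g : R -> R) (psi : Mplus R -> R) (a : R)
    (f : R -> Mplus R -> R) : Prop :=
  forall b : R, (forall z, z \in I11 -> 0 < g z + b) ->
  exists2 fb : R -> Mplus R -> R,
    HJ_solution_pos (fun z => g z + b) (fun mu => psi mu + a * b * mass mu) fb &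
    forall (t : R) (mu : Mplus R), 0 <= t ->
      f t mu = fb t mu - a * b * mass mu - a ^+ 2 * b * t / 2.

End infinite_dimensional.

(* Main.v *)
Require Import Defs.
From mathcomp Require Import all_boot all_order all_algebra.
From mathcomp Require Import all_classical all_reals all_analysis.
From mathcomp Require Import measurable_realfun ring lra.

Set Implicit Arguments.
Unset Strict Implicit.
Unset Printing Implicit Defensive.

Import Order.TTheory GRing.Theory Num.Theory.
Import numFieldNormedType.Exports.

Local Open Scope classical_set_scope.
Local Open Scope ring_scope.

(** Why the formula holds.

Write q for the positive semidefinite kernel g + b, bounded below by m > 0, and
replace psi by psi + a b mass, whose derivatives are then potentials for q of
measures of mass a.  Solving the equation for q and shifting back gives the
statement for g.

On the dyadic level K the Hamiltonian Hfun is compared with the function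
y |-> max (z . y - z . Q z / 2) over the nonnegative z of mass at most M.  It
dominates this maximum everywhere by the Fenchel-Young inequality, because Q is
positive semidefinite (Hfun_ge); and it is equal to it at every y of size at
most L, the Lipschitz constant of psi, because there the complementarity
conditions at the maximizer z exhibit Q z as a competitor in the infimum that
defines Hfun (Hfun_le).  Hence the Hopf-Lax function hopf, built from the
quadratic energy, is a viscosity solution (hopf_solution): it is L-Lipschitz in
x, so a smooth function that touches it from below has a gradient of size at
most L, where the two Hamiltonians agree.  Uniqueness is part of what it means
to be the solution, so the approximate solution is hopf: a maximum over atomic
measures with mass at most M of the payoff psi (mu + t nu) - t/2 energy nu.

To let K tend to infinity one needs psi to be continuous for weak convergence.
Every derivative of psi is the potential of a measure of mass a, hence a
Lipschitz function with a constant independent of the measure.  A mean value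
inequality (gateaux_mean_value) turns this into a bound on psi rho - psi nu by
the bounded-Lipschitz distance.  The payoff is then continuous.  The maximizers
at the levels K have a weak limit nus along an ultrafilter (weak_compact), and
every measure is the weak limit of its dyadic discretizations (coords_close); so
the limit of the approximate solutions is the maximum of the payoff over all
measures of mass at most M, and it is attained at nus.

It remains to see that nus has mass a (optimal).  The derivative at mu + t nus
is the potential of some eta of mass a.  Varying nus along Dirac masses and
along multiples of itself gives: the potential of eta is at most that of nus
everywhere, and both have the same integral against nus.  So the energy of the
signed measure eta - nus is at most 0, hence is 0, and then its potential
vanishes since q is positive semidefinite.  At the point 0 the potential of a
measure is q 0 times its mass, so nus and eta have the same mass. *)

(** * Integration of bounded functions on [-1, 1] *)

Section integrals.
Context {R : realType}.
Local Notation RM := (measurableTypeR R).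
Local Notation fmeas := {finite_measure set RM -> \bar R}.

Lemma I11E (x : R) : I11 x = (-1 <= x <= 1) :> Prop.
Proof. by rewrite /I11/= in_itv. Qed.

Lemma measurable_I11 : measurable (I11 : set RM).
Proof. exact: measurable_itv. Qed.
Hint Resolve measurable_I11 : core.

Lemma I11M (x y : R) : I11 x -> I11 y -> I11 (x * y).
Proof.
rewrite !I11E -!ler_norml => hx hy.
by rewrite normrM -[1]mulr1 ler_pM.
Qed.

Definition bmeas (h : R -> R) :=
  measurable_fun (I11 : set RM) (h : RM -> R) /\
  exists M : R, forall x, I11 x -> `|h x| <= M.

Definition lip_on (L : R) (h : R -> R) :=
  forall x y, I11 x -> I11 y -> `|h x - h y| <= L * `|x - y|.

Lemma lip_onW (L L' : R) h : L <= L' -> lip_on L h -> lip_on L' h.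
Proof.
by move=> LL' hL x y hx hy; rewrite (le_trans (hL x y hx hy))// ler_wpM2r.
Qed.

Lemma lip_on_bmeas (L : R) h : lip_on L h -> bmeas h.
Proof.
have I0 : I11 (0 : R) by rewrite I11E; lra.
wlog L0 : L / 0 < L.
  move=> wl hL; apply: (wl (`|L| + 1)); first by rewrite ltr_wpDl.
  by apply: lip_onW hL; rewrite (le_trans (ler_norm L))// lerDl.
move=> hL; split.
  apply: subspace_continuous_measurable_fun; first exact: measurable_I11.
  apply/subspace_continuousP => x Ix; apply/cvgrPdist_le => e e0.
  rewrite near_withinE; near=> y => Iy.
  rewrite (le_trans (hL x y Ix Iy))// -ler_pdivlMl//.
  by near: y; apply: cvgr_dist_le => //; rewrite mulr_gt0// invr_gt0.
exists (`|h 0| + L) => x Ix.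
rewrite -[h x](subrK (h 0)) addrC (le_trans (ler_normD _ _))// lerD2l.
rewrite (le_trans (hL _ _ Ix I0))// subr0 ler_piMr//; first exact: ltW.
by move: Ix; rewrite I11E ler_norml.
Unshelve. all: by end_near. Qed.

Lemma bmeas_cst c : bmeas (cst c).
Proof. by split; [exact: measurable_cst | exists `|c|]. Qed.

Lemma bmeasD h k : bmeas h -> bmeas k -> bmeas (fun x => h x + k x).
Proof.
move=> [mh [M hM]] [mk [N hN]]; split; first exact: measurable_funD.
by exists (M + N) => x Ix; rewrite (le_trans (ler_normD _ _))// lerD ?hM ?hN.
Qed.

Lemma bmeasZ c h : bmeas h -> bmeas (fun x => c * h x).
Proof.
move=> [mh [M hM]]; split; first exact: measurable_funM.
by exists (`|c| * M) => x Ix; rewrite normrM ler_wpM2l ?hM.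
Qed.

Lemma bmeasN h : bmeas h -> bmeas (fun x => - h x).
Proof.
by move=> /(bmeasZ (-1)) hb; under eq_fun do rewrite -mulN1r.
Qed.

Lemma bmeasB h k : bmeas h -> bmeas k -> bmeas (fun x => h x - k x).
Proof. by move=> bh bk; apply: bmeasD => //; exact: bmeasN. Qed.

Definition integ (m : fmeas) (h : R -> R) : R := \int[m]_(x in I11) h x.

Definition tot (m : fmeas) : R := fine (m (I11 : set RM)).

Lemma tot_ge0 m : 0 <= tot m. Proof. exact: fine_ge0. Qed.

Lemma bmeas_integrable (m : fmeas) h : bmeas h -> m.-integrable I11 (EFin \o h).
Proof.
move=> [mh [M hM]]; apply: measurable_bounded_integrable => //.
- by rewrite ltey_eq fin_num_measure.
- exists M; split; first exact: num_real.
  by move=> N MN x Ix /=; rewrite (le_trans (hM _ Ix))// ltW.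
Qed.

Lemma integD m h k : bmeas h -> bmeas k ->
  integ m (fun x => h x + k x) = integ m h + integ m k.
Proof. by move=> bh bk; rewrite /integ RintegralD//; exact: bmeas_integrable. Qed.

Lemma integZ m c h : bmeas h -> integ m (fun x => c * h x) = c * integ m h.
Proof. by move=> bh; rewrite /integ RintegralZl//; exact: bmeas_integrable. Qed.

Lemma integB m h k : bmeas h -> bmeas k ->
  integ m (fun x => h x - k x) = integ m h - integ m k.
Proof. by move=> bh bk; rewrite /integ RintegralB//; exact: bmeas_integrable. Qed.

Lemma integ_cst m c : integ m (cst c) = c * tot m.
Proof. by rewrite /integ Rintegral_cst. Qed.

Lemma eq_integ m h k : (forall x, I11 x -> h x = k x) -> integ m h = integ m k.
Proof. by move=> hk; apply: eq_Rintegral => x /set_mem /hk. Qed.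

Lemma ler_integ m h k : bmeas h -> bmeas k ->
  (forall x, I11 x -> h x <= k x) -> integ m h <= integ m k.
Proof. by move=> bh bk hk; apply: le_Rintegral => //; exact: bmeas_integrable. Qed.

Lemma ler_norm_integ m h M : bmeas h ->
  (forall x, I11 x -> `|h x| <= M) -> `|integ m h| <= M * tot m.
Proof.
move=> bh hM; rewrite ler_norml -mulNr -!integ_cst.
by apply/andP; split; apply: ler_integ => //; do ?exact: bmeas_cst;
  move=> x /hM; rewrite ler_norml => /andP[].
Qed.

(** A bounded integrand becomes nonnegative after adding a constant, whose
integral only involves the masses; so nonnegative integrands suffice. *)
Lemma integ_add_measure (rho mu nu : fmeas) (c : R) (c0 : 0 <= c) :
  (forall A, measurable A -> A `<=` I11 -> rho A = mu A + c%:E * nu A)%E ->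
  forall h, bmeas h -> integ rho h = integ mu h + c * integ nu h.
Proof.
move=> rE h bh.
have totE : tot rho = tot mu + c * tot nu.
  rewrite /tot rE// fineD// ?fineM//.
  - by rewrite fin_num_measure.
  - by rewrite fin_num_measure.
  - by rewrite fin_numM// fin_num_measure.
have ge0_case k : bmeas k -> (forall x, I11 x -> 0 <= k x) ->
    integ rho k = integ mu k + c * integ nu k.
  move=> bk k0.
  have kE : measurable_fun I11 (EFin \o k) by apply/measurable_EFinP; case: bk.
  have k0' x : I11 x -> (0 <= (EFin \o k) x)%E by move=> Ix; rewrite lee_fin k0.
  rewrite /integ /Rintegral.
  rewrite (eq_measure_integral (measure_add mu (mscale (NngNum c0) nu))).
    rewrite (ge0_integral_measure_add mu (mscale (NngNum c0) nu) measurable_I11 k0' kE).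
    rewrite ge0_integral_mscale// fineD// ?fineM//.
    - exact: (integrable_fin_num _ (bmeas_integrable nu bk)).
    - exact: (integrable_fin_num _ (bmeas_integrable mu bk)).
    - rewrite fin_numM//.
      exact: (integrable_fin_num _ (bmeas_integrable nu bk)).
  move=> A mA AI; rewrite [RHS]measure_addE.
  exact: rE.
have [mh [M hM]] := bh.
have bM := bmeas_cst M.
have hE m : integ m h = integ m (fun x => h x + cst M x) - M * tot m.
  by rewrite integD// integ_cst addrK.
rewrite !hE ge0_case; first by rewrite totE; ring.
- exact: bmeasD.
- by move=> x /hM; rewrite ler_norml /= => /andP[? _]; lra.
Qed.

End integrals.
#[export] Hint Resolve measurable_I11 : core.

(** * A mean value inequality in the plane *)

Section planar.
Context {R : realType}.
Implicit Types (F : R -> R -> R) (L e : R).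

Definition lip2 L F := forall s t s' t',
  `|F s t - F s' t'| <= L * (`|s - s'| + `|t - t'|).

(** The increments of F to the left in s and to the right in t are controlled
to first order, by slopes whose difference is at most e.  These are the two
one-sided moves that go backwards along the direction (1, -1). *)
Definition dini_gap e F := forall s t, 0 < s -> 0 < t -> exists p q, p - q <= e /\
  forall k, 0 < k -> exists2 h0, 0 < h0 & forall h, 0 < h -> h < h0 ->
    F s t - p * h - k * h <= F (s - h) t /\ F s t + q * h - k * h <= F s (t + h).

(** The slopes of F are only controlled along the axes, so the mean value
theorem does not apply on the segment from (d, 1 + d) to (1 + d, d).  Instead,
use coordinates (tau, n) along the segment and across it and maximize
F - th tau - N n^2 over a thin rectangle, for some th > e.  At a maximizer with
tau > 0, moving back along the two axes would force th <= e; so tau = 0 there,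
and comparing with the endpoint tau = 1 bounds the increment of F. *)
Lemma planar_gap F L e (L0 : 0 < L) : lip2 L F -> dini_gap e F ->
  forall d, 0 < d -> F (1 + d) d - F d (1 + d) <= e.
Proof.
move=> FL Fe d d0; apply/ler_addgt0Pr => k0 k00.
pose k := k0 / 2; have k_gt0 : 0 < k by rewrite divr_gt0.
pose th := e + k; pose c := d / 2; have c0 : 0 < c by rewrite divr_gt0.
pose f (p : R * R) := F (p.1 + p.2 + d) (1 - p.1 + p.2 + d).
(* The first bound keeps the maximizer away from the sides n = - c and n = c;
   the second one bounds the error L^2 / N at tau = 0 by k. *)
pose N := Num.max (3 * L / c) (L ^+ 2 / k).
have NL : 2 * L < N * c.
  rewrite -ltr_pdivrMr// lt_max; apply/orP; left.
  by rewrite ltr_pM2r ?invr_gt0// ltr_pM2r//; lra.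
have Nk : L ^+ 2 <= N * k by rewrite -ler_pdivrMr// le_max lexx orbT.
have N0 : 0 < N by rewrite lt_max divr_gt0// mulr_gt0.
pose G (p : R * R) := f p - (th * p.1 + N * p.2 ^+ 2).
pose A : set (R * R) := `[0, 1] `*` `[- c, c].
have fL p q : `|f p - f q| <= L * (2 * `|p.1 - q.1| + 2 * `|p.2 - q.2|).
  rewrite (le_trans (FL _ _ _ _))// ler_pM2l//.
  rewrite (_ : _ + _ + d - _ = (p.1 - q.1) + (p.2 - q.2)); last by ring.
  rewrite [X in _ + `|X|](_ : _ = (q.1 - p.1) + (p.2 - q.2)); last by ring.
  have := ler_normD (p.1 - q.1) (p.2 - q.2).
  have := ler_normD (q.1 - p.1) (p.2 - q.2); rewrite (distrC q.1); lra.
have cf : continuous f.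
  move=> p; apply/cvgrPdist_le => eps eps0.
  pose r := L^-1 * eps / 4.
  have r0 : 0 < r by rewrite !mulr_gt0 ?invr_gt0.
  have c1 : x.1 @[x --> p] --> p.1 by apply: cvg_fst.
  have c2 : x.2 @[x --> p] --> p.2 by apply: cvg_snd.
  near=> q; rewrite (le_trans (fL _ _))// -ler_pdivlMl//.
  have H1 : `|p.1 - q.1| <= r by near: q; exact: cvgr_dist_le c1 _ r0.
  have H2 : `|p.2 - q.2| <= r by near: q; exact: cvgr_dist_le c2 _ r0.
  by rewrite /r in H1 H2; lra.
have cG : continuous G.
  move=> p; apply: cvgB; first exact: cf.
  apply: cvgD; apply: cvgM; [exact: cvg_cst|exact: cvg_fst|exact: cvg_cst|].
  by rewrite expr2; apply: cvgM; exact: cvg_snd.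
have cA : compact A by apply: compact_setX; exact: segment_compact.
have A0 : A (1, 0) by split => /=; rewrite in_itv/=; lra.
have [[t n] /set_mem[/=]] := compact_EVT_max (ex_intro _ _ A0) cA (continuous_subspaceT cG).
rewrite !in_itv/= => /andP[t0 t1] /andP[nc nc'] Gmax.
have {}Gmax p : A p -> G p <= G (t, n) by move=> /mem_set; exact: Gmax.
have n2 : N * `|n| <= 2 * L.
  rewrite leNgt; apply/negP => nL.
  have n0 : 0 < `|n|.
    by rewrite normr_gt0; apply/eqP => n0; move: nL; rewrite n0 normr0; lra.
  have An : A (t, 0) by split; rewrite /= in_itv/=; lra.
  have := Gmax _ An; rewrite /G /=.
  have := fL (t, 0) (t, n); rewrite /= subrr normr0 mulr0 add0r sub0r normrN.
  rewrite ler_norml => /andP[+ _].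
  move: nL; rewrite -(ltr_pM2l n0).
  have -> : `|n| * (N * `|n|) = N * n ^+ 2.
    by rewrite -(real_normK (num_real n)); ring.
  by rewrite expr0n/=; lra.
have n_lt : `|n| < c.
  by rewrite -(ltr_pM2l N0) (le_lt_trans n2).
have [t_gt0|t_le0] := ltP 0 t.
  (* Here p and q are the slopes at the maximizer; lowering s by h and raising t
     by h both decrease tau by h / 2. *)
  have [s0 u0] : 0 < t + n + d /\ 0 < 1 - t + n + d.
    by move: n_lt; rewrite ltr_norml /c => /andP[]; lra.
  have [p [q [pq Fpq]]] := Fe _ _ s0 u0.
  have k4 : 0 < k / 8 by rewrite divr_gt0.
  have [h0 h00 {}Fpq] := Fpq _ k4.
  pose h := Num.min (Num.min (h0 / 2) t) (Num.min (k / N) (c - `|n|)).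
  have h_gt0 : 0 < h by rewrite !lt_min t_gt0 !divr_gt0//= subr_gt0.
  have [[hh0 ht] [hN hc]] : (h <= h0 / 2 /\ h <= t) /\ (h <= k / N /\ h <= c - `|n|).
    by rewrite /h !ge_min !lexx !orbT.
  have hlt : h < h0 by lra.
  have [H1 H2] := Fpq _ h_gt0 hlt.
  rewrite ler_pdivlMr// in hN.
  have nb : - `|n| <= n <= `|n| by rewrite -ler_norml.
  have G1 := Gmax (t - h / 2, n - h / 2); have G2 := Gmax (t - h / 2, n + h / 2).
  have {}G1 : G (t - h / 2, n - h / 2) <= G (t, n).
    by apply: G1; split; rewrite /= in_itv/=; lra.
  have {}G2 : G (t - h / 2, n + h / 2) <= G (t, n).
    by apply: G2; split; rewrite /= in_itv/=; lra.
  move: G1 G2; rewrite /G /f /=.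
  rewrite (_ : t - h / 2 + (n - h / 2) + d = t + n + d - h); last by field.
  rewrite (_ : 1 - (t - h / 2) + (n - h / 2) + d = 1 - t + n + d); last by field.
  rewrite (_ : t - h / 2 + (n + h / 2) + d = t + n + d); last by field.
  rewrite (_ : 1 - (t - h / 2) + (n + h / 2) + d = 1 - t + n + d + h); last by field.
  move=> G1 G2; exfalso.
  have : h * (th - (p - q) - k / 4 - N * h / 2) <= 0 by lra.
  by rewrite pmulr_rle0// /th; lra.
have {t_le0 t0} t00 : t = 0 by apply/le_anti; rewrite t_le0.
have := Gmax _ A0; rewrite /G /f /= t00.
have := FL (0 + n + d) (1 - 0 + n + d) d (1 + d).
have -> : 0 + n + d - d = n by ring.
have -> : 1 - 0 + n + d - (1 + d) = n by ring.
rewrite ler_norml => /andP[_ fn].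
have : 2 * L * `|n| <= N * n ^+ 2 + k.
  rewrite -(ler_pM2l N0) -subr_ge0.
  have -> : N * (N * n ^+ 2 + k) - N * (2 * L * `|n|)
      = (N * `|n| - L) ^+ 2 + (N * k - L ^+ 2).
    by rewrite -(real_normK (num_real n)); ring.
  by rewrite addr_ge0 ?sqr_ge0// subr_ge0.
have -> : 1 + 0 + d = 1 + d by ring.
have -> : 1 - 1 + 0 + d = d by ring.
by rewrite expr0n/= /th /k; lra.
Unshelve. all: by end_near. Qed.

(** The endpoints (1, 0) and (0, 1) lie on the boundary of the quadrant where
the slopes are known; they are reached by continuity. *)
Lemma planar_mean_value F L e : lip2 L F -> dini_gap e F -> F 1 0 - F 0 1 <= e.
Proof.
wlog L0 : L / 0 < L.
  move=> wl FL; apply: (wl (`|L| + 1)); first by rewrite ltr_wpDl.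
  move=> s t s' t'; rewrite (le_trans (FL _ _ _ _))// ler_wpM2r ?addr_ge0//.
  by rewrite (le_trans (ler_norm L))// lerDl.
move=> FL Fe; apply/ler_addgt0Pr => k k0.
pose d := k / (4 * L); have d0 : 0 < d by rewrite divr_gt0// mulr_gt0.
have := planar_gap L0 FL Fe d0.
have := FL 1 0 (1 + d) d; have := FL d (1 + d) 0 1.
have -> : 1 - (1 + d) = - d by ring.
have -> : 1 + d - 1 = d by ring.
rewrite sub0r subr0 normrN !ler_norml gtr0_norm//.
have : 4 * L * d = k by rewrite /d; field; rewrite gt_eqF.
by move=> ? /andP[_ ?] /andP[_ ?]; lra.
Qed.

End planar.

(** * Total variation and Gateaux derivatives *)

Section functionals.
Context {R : realType}.
Local Notation RM := (measurableTypeR R).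
Local Notation fmeas := {finite_measure set RM -> \bar R}.
Implicit Types (mu nu rho : Mplus R) (psi : Mplus R -> R).

Lemma fine_measure_le (m : fmeas) A : measurable A -> A `<=` I11 ->
  0 <= fine (m A) <= tot m.
Proof.
move=> mA AI; rewrite fine_ge0//= /tot fine_le ?fin_num_measure//.
by apply: le_measure; [exact: (mem_set mA)|exact: (mem_set measurable_I11)|exact: AI].
Qed.

Lemma TV_le mu nu c :
  (forall A : set RM, measurable A -> A `<=` I11 ->
    `|fine (mu A) - fine (nu A)| <= c) -> TV mu nu <= c.
Proof.
move=> h; apply: ge_sup => [|_ /= [A [mA AI] <-]]; last exact: h.
exists `|fine (mu set0) - fine (nu set0)| => /=; exists set0 => //.
by split; [exact: measurable0|exact: sub0set].
Qed.

Lemma le_TV mu nu (A : set RM) : measurable A -> A `<=` I11 ->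
  `|fine (mu A) - fine (nu A)| <= TV mu nu.
Proof.
move=> mA AI; apply: ub_le_sup; last by exists A.
exists (tot mu + tot nu) => _ /= [B [mB BI] <-].
have /andP[] := fine_measure_le mu mB BI; have /andP[] := fine_measure_le nu mB BI.
move=> ? ? ? ?; rewrite ler_norml; apply/andP; split; lra.
Qed.

Lemma TV_ge0 mu nu : 0 <= TV mu nu.
Proof.
by apply: le_trans (normr_ge0 _) (le_TV (A := I11) _ _ measurable_I11 _).
Qed.

Lemma lipschitz_TVW psi L L' : L <= L' -> lipschitz_TV psi L -> lipschitz_TV psi L'.
Proof.
by move=> LL h mu nu; rewrite (le_trans (h mu nu))// ler_wpM2r ?TV_ge0.
Qed.

Lemma lipschitz_TV_gt0 psi :
  (exists L : R, lipschitz_TV psi L) -> exists2 L : R, 0 < L & lipschitz_TV psi L.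
Proof.
move=> [L h]; exists (`|L| + 1); first by rewrite ltr_wpDl.
by apply: lipschitz_TVW h; rewrite (le_trans (ler_norm L))// lerDl.
Qed.

Lemma lipschitz_TV_dist psi L mu nu c : 0 <= L -> lipschitz_TV psi L ->
  (forall A : set RM, measurable A -> A `<=` I11 ->
    `|fine (mu A) - fine (nu A)| <= c) -> `|psi mu - psi nu| <= L * c.
Proof.
by move=> L0 h hc; rewrite (le_trans (h mu nu))// ler_wpM2l// TV_le.
Qed.

(** A functional that is Lipschitz for TV does not see the values of a measure
on sets that are not measurable or not contained in [-1, 1]. *)
Lemma lipschitz_TV_ext psi L mu nu : lipschitz_TV psi L ->
  (forall A : set RM, measurable A -> A `<=` I11 -> mu A = nu A) ->
  psi mu = psi nu.
Proof.
move=> h e; apply/eqP; rewrite -subr_eq0 -normr_le0.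
rewrite (le_trans (lipschitz_TV_dist (c := 0) (normr_ge0 L) _ _)) ?mulr0//.
  by apply: lipschitz_TVW h; exact: ler_norm.
by move=> A mA AI; rewrite e// subrr normr0.
Qed.

Lemma mass_lipschitz_TV : lipschitz_TV (@mass R) 1.
Proof. by move=> mu nu; rewrite mul1r; exact: le_TV. Qed.

Lemma Mplus_cover mu (A : set RM) : measurable A -> mu A = mu (A `&` I11).
Proof.
move=> mA; rewrite [in LHS](_ : A = (A `&` I11) `|` (A `&` ~` I11)); last first.
  by rewrite -setIUr setUv setIT.
have mI : measurable (~` (I11 : set RM)) by exact: measurableC.
rewrite measureU//; [|exact: measurableI|exact: measurableI|]; last first.
  by rewrite setIACA setICr setI0.
rewrite [X in (_ + X)%E](_ : _ = 0%E) ?adde0//.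
apply/eqP; rewrite eq_le measure_ge0 andbT -(Mplus_supp mu).
by apply: le_measure; [exact: (mem_set (measurableI _ _ mA mI))|exact: (mem_set mI)|exact: subIsetr].
Qed.

Lemma max0_ge0 (s : R) : 0 <= Num.max s 0.
Proof. by rewrite le_max lexx orbT. Qed.

Definition nneg_part (s : R) : {nonneg R} := NngNum (max0_ge0 s).

Let zero_fin : fin_num_fun (mzero : {measure set RM -> \bar R}).
Proof. by []. Qed.

Definition Mplus0 : Mplus R :=
  @MkMplus R (pack_fin_measure zero_fin) erefl.

(** The measure s rho + t nu; negative coefficients are replaced by 0, so that
it is a Lipschitz function of the pair (s, t) on the whole plane. *)
Definition comb (s t : R) rho nu : Mplus R :=
  translate (translate Mplus0 (nneg_part s) rho) (nneg_part t) nu.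

Lemma combE s t rho nu (A : set RM) : comb s t rho nu A =
  ((Num.max s 0)%:E * rho A + (Num.max t 0)%:E * nu A)%E.
Proof. by rewrite /comb !translateE [X in (X + _ + _)%E](_ : _ = 0%E)// add0e. Qed.

Lemma fine_comb s t rho nu (A : set RM) : measurable A ->
  fine (comb s t rho nu A) = Num.max s 0 * fine (rho A) + Num.max t 0 * fine (nu A).
Proof. by move=> mA; rewrite combE fineD ?fineM ?fin_numM ?fin_num_measure. Qed.

Lemma dist_max0 (s s' : R) : `|Num.max s 0 - Num.max s' 0| <= `|s - s'|.
Proof.
have [hs|hs] := leP s 0; have [hs'|hs'] := leP s' 0; rewrite ?subrr ?normr0 //.
- rewrite (ler0_norm (x := s - s')); last lra.
  by rewrite sub0r normrN gtr0_norm//; lra.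
- by rewrite subr0 !gtr0_norm//; lra.
Qed.

Lemma comb_dist s t s' t' rho nu (A : set RM) : measurable A -> A `<=` I11 ->
  `|fine (comb s t rho nu A) - fine (comb s' t' rho nu A)| <=
    (tot rho + tot nu) * (`|s - s'| + `|t - t'|).
Proof.
move=> mA AI; rewrite !fine_comb//.
have -> (x y z w a b : R) : x * a + y * b - (z * a + w * b) = (x - z) * a + (y - w) * b.
  by ring.
rewrite (le_trans (ler_normD _ _))// !normrM.
have /andP[r0 r1] := fine_measure_le rho mA AI.
have /andP[n0 n1] := fine_measure_le nu mA AI.
rewrite (ger0_norm r0) (ger0_norm n0).
have H1 := ler_pM (normr_ge0 _) r0 (dist_max0 s s') r1.
have H2 := ler_pM (normr_ge0 _) n0 (dist_max0 t t') n1.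
rewrite (le_trans (lerD H1 H2))// mulrDl !mulrDr.
have := mulr_ge0 (tot_ge0 rho) (normr_ge0 (t - t')).
have := mulr_ge0 (tot_ge0 nu) (normr_ge0 (s - s')).
by rewrite ![_ * tot _]mulrC; lra.
Qed.

Lemma gateaux_near psi mu nu l : gateaux psi mu nu l ->
  forall k, 0 < k -> exists2 h0, 0 < h0 & forall h rho, h != 0 -> `|h| < h0 ->
    (forall A : set RM, measurable A -> rho A = mu A + h%:E * nu A)%E ->
    `|psi rho - psi mu - l * h| <= k * `|h|.
Proof.
move=> g k k0; have := g k k0; rewrite /dnbhs /within /= => /nbhs_ballP[h0 /= h00 H].
exists h0 => // h rho hn0 hh0 rE.
have := H h; rewrite /ball/= sub0r normrN => /(_ hh0 hn0 rho rE) /ltW.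
have -> : psi rho - psi mu - l * h = ((psi rho - psi mu) / h - l) * h.
  by field.
by move=> ?; rewrite normrM ler_wpM2r.
Qed.

Lemma comb_shift s t h rho nu (A : set RM) : measurable A -> 0 <= s -> 0 <= s + h ->
  (comb (s + h) t rho nu A = comb s t rho nu A + h%:E * rho A)%E.
Proof.
move=> mA s0 sh0; have fr := fin_num_measure rho _ mA.
rewrite !combE (max_idPl s0) (max_idPl sh0) -(fineK fr) -(fineK (fin_num_measure nu _ mA)).
by rewrite -!EFinM -!EFinD; congr EFin; ring.
Qed.

Lemma combC s t rho nu (A : set RM) : comb s t rho nu A = comb t s nu rho A.
Proof. by rewrite !combE addeC. Qed.

(** The segment from nu to rho has a signed direction, in which no derivative of
psi is given.  But F s t = psi (s rho + t nu) has two-sided derivatives along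
both axes inside the quadrant, and the planar mean value inequality applies. *)
Lemma gateaux_mean_value psi L (D : Mplus R -> R -> R) :
  lipschitz_TV psi L -> (forall mu, gateaux_density psi mu (D mu)) ->
  forall rho nu e, (forall mu, `|integ rho (D mu) - integ nu (D mu)| <= e) ->
  `|psi rho - psi nu| <= e.
Proof.
move=> psiL psiD.
wlog L0 : L psiL / 0 <= L.
  by move=> wl; apply: (wl `|L|) => //; apply: lipschitz_TVW psiL; exact: ler_norm.
suff main rho nu e : (forall mu, integ rho (D mu) - integ nu (D mu) <= e) ->
    psi rho - psi nu <= e.
  move=> rho nu e h; rewrite ler_norml; apply/andP; split.
    rewrite lerNl opprB; apply: main => mu; rewrite -opprB lerNl.
    by have := h mu; rewrite ler_norml => /andP[].
  by apply: main => mu; have := h mu; rewrite ler_norml => /andP[].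
move=> he; pose F s t := psi (comb s t rho nu).
have -> : psi rho = F 1 0.
  apply: lipschitz_TV_ext psiL _ => A mA AI; rewrite combE maxxx mul0e adde0.
  by rewrite (max_idPl _) ?ler01// mul1e.
have -> : psi nu = F 0 1.
  apply: lipschitz_TV_ext psiL _ => A mA AI; rewrite combE maxxx mul0e add0e.
  by rewrite (max_idPl _) ?ler01// mul1e.
apply: (@planar_mean_value _ _ (L * (tot rho + tot nu))).
  move=> s t s' t'; rewrite -mulrA; apply: lipschitz_TV_dist => // A mA AI.
  exact: comb_dist.
move=> s t s0 t0; exists (integ rho (D (comb s t rho nu))), (integ nu (D (comb s t rho nu))).
split=> // k k0; have [_ _ Dg] := psiD (comb s t rho nu).
have [h1 h10 H1] := gateaux_near (Dg rho) k0.
have [h2 h20 H2] := gateaux_near (Dg nu) k0.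
exists (Num.min s (Num.min h1 h2)); first by rewrite !lt_min s0 h10 h20.
move=> h h0; rewrite !lt_min => /and3P[hs hh1 hh2]; split.
  have := H1 (- h) (comb (s - h) t rho nu).
  rewrite oppr_eq0 gt_eqF// normrN gtr0_norm// => /(_ isT hh1).
  have /[swap] /[apply] : forall A : set RM, measurable A ->
     (comb (s - h) t rho nu A = comb s t rho nu A + (- h)%:E * rho A)%E.
    by move=> A mA; apply: comb_shift => //; [exact: ltW|rewrite subr_ge0 ltW].
  by rewrite ler_norml /F /integ => /andP[+ _]; lra.
have := H2 h (comb s (t + h) rho nu).
rewrite gt_eqF// gtr0_norm// => /(_ isT hh2).
have /[swap] /[apply] : forall A : set RM, measurable A ->
   (comb s (t + h) rho nu A = comb s t rho nu A + h%:E * nu A)%E.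
  move=> A mA; rewrite !(combC s); apply: comb_shift => //; first exact: ltW.
  by rewrite addr_ge0// ltW.
by rewrite ler_norml /F /integ => /andP[+ _]; lra.
Qed.

End functionals.

Section combinations.
Context {R : realType}.
Implicit Types (rho nu : Mplus R) (h : R -> R).

Lemma integ_translate rho (t : {nonneg R}) nu h : bmeas h ->
  integ (translate rho t nu) h = integ rho h + t%:num * integ nu h.
Proof. by move=> bh; apply: integ_add_measure => // A _ _; exact: translateE. Qed.

Lemma tot_translate rho (t : {nonneg R}) nu :
  tot (translate rho t nu) = tot rho + t%:num * tot nu.
Proof.
by have := @integ_translate rho t nu (cst 1) (bmeas_cst 1); rewrite !integ_cst !mul1r.
Qed.

Lemma integ0 h : bmeas h -> integ (@Mplus0 R) h = 0.
Proof.
move=> bh; have [_ [M hM]] := bh.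
apply/eqP; rewrite -normr_le0 (le_trans (ler_norm_integ _ bh hM))//.
by rewrite [tot _](_ : _ = 0) ?mulr0.
Qed.

Lemma integ_comb s t rho nu h : bmeas h ->
  integ (comb s t rho nu) h = Num.max s 0 * integ rho h + Num.max t 0 * integ nu h.
Proof. by move=> bh; rewrite !integ_translate// integ0// add0r. Qed.

End combinations.

(** * Kernels, potentials and weak closeness *)

Section kernels.
Context {R : realType}.
Local Notation RM := (measurableTypeR R).
Local Notation fmeas := {finite_measure set RM -> \bar R}.
Implicit Types (m rho nu : fmeas) (g q h : R -> R).

Lemma C1_diff_quotient g : C1_on_I11 g -> exists2 g' : R -> R, {within I11, continuous g'} &
  forall x, I11 x -> forall e, 0 < e -> exists2 d, 0 < d &
    forall y, I11 y -> `|y - x| < d -> `|g y - g x - g' x * (y - x)| <= e * `|y - x|.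
Proof.
move=> [g' cg' H]; exists g' => // x /mem_set /H/cvgrPdist_le H1 e e0.
have := H1 e e0; rewrite near_withinE /dnbhs /within /= => /nbhs_ballP[d /= d0 Hd].
exists d => // y Iy yd; have [->|yx] := eqVneq y x.
  by rewrite !subrr mulr0 subrr normr0 mulr0.
have yx0 : y - x != 0 by rewrite subr_eq0.
have := Hd y; rewrite /ball/= distrC => /(_ yd yx Iy) => H2.
have -> : g y - g x - g' x * (y - x) = - (g' x - (g y - g x) / (y - x)) * (y - x).
  by field.
by rewrite normrM normrN ler_wpM2r.
Qed.

(** By the mean value theorem: in the interior of [-1, 1] the derivative within
the interval is an ordinary derivative. *)
Lemma C1_lipschitz g : C1_on_I11 g -> exists2 C, 0 <= C & lip_on C g.
Proof.
move=> /C1_diff_quotient[g' cg' Hg].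
have [C C0 HC] : exists2 C, 0 <= C & forall x, I11 x -> `|g' x| <= C.
  have N11 : (-1 : R) <= 1 by lra.
  have [c1 _ max] := EVT_max N11 cg'; have [c2 _ min] := EVT_min N11 cg'.
  exists (`|g' c1| + `|g' c2|); first by rewrite addr_ge0.
  move=> x Ix; have := max x Ix; have := min x Ix.
  have := ler_norm (g' c1); have := ler_normr (- g' c2) (g' c2).
  rewrite lexx orbT => /esym.
  have := normr_ge0 (g' c1); have := normr_ge0 (g' c2).
  by move=> ? ? ? ? ? ?; rewrite ler_norml; apply/andP; split; lra.
exists C => //.
suff main x y : I11 x -> I11 y -> x < y -> `|g y - g x| <= C * (y - x).
  move=> x y Ix Iy; have [xy|yx|->] := ltgtP x y.
  - by rewrite distrC (distrC x) (gtr0_norm (x := y - x)) ?subr_gt0//; exact: main.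
  - by rewrite (gtr0_norm (x := x - y)) ?subr_gt0//; exact: main.
  - by rewrite !subrr normr0 mulr0.
move=> Ix Iy xy.
have sub z : x <= z <= y -> I11 z by move: Ix Iy; rewrite !I11E; lra.
have der z : z \in `]x, y[%R -> is_derive z 1 g (g' z).
  rewrite in_itv/= => /andP[xz zy]; have Iz : I11 z by apply: sub; lra.
  have lim : h^-1 *: ((g \o shift z) (h *: 1) - g z) @[h --> 0^'] --> g' z.
    apply/cvgrPdist_le => e e0; have [d d0 Hd] := Hg z Iz e e0.
    near=> h; have h0 : h != 0 by near: h; exact: nbhs_dnbhs_neq.
    have hd : `|h| < Num.min d (Num.min (z - x) (y - z)).
      near: h; apply: dnbhs0_lt; rewrite !lt_min d0/=; apply/andP; split; lra.
    move: hd; rewrite !lt_min => /and3P[hd h1 h2].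
    have Ih : I11 (h + z) by apply: sub; move: h1 h2; rewrite !ltr_norml; lra.
    have := Hd _ Ih; rewrite addrK => /(_ hd).
    rewrite /= /GRing.scale /= mulr1 => H.
    have -> : g' z - h^-1 * (g (h + z) - g z) =
      - h^-1 * (g (h + z) - g z - g' z * h) by field.
    by rewrite normrM normrN normfV ler_pdivrMl ?normr_gt0// [leRHS]mulrC.
  have dg : derivable g z 1 by apply/cvg_ex; exists (g' z).
  have vg : 'D_1 g z = g' z by exact: (cvg_lim (@Rhausdorff R) lim).
  by rewrite -vg; exact: derivableP.
have cont : {within `[x, y], continuous g}.
  apply/subspace_continuousP => z /=; rewrite in_itv/= => hz.
  have Iz := sub _ hz; have [d d0 Hd] := Hg z Iz 1 ltr01.
  apply/cvgrPdist_le => e e0; rewrite near_withinE; near=> w => hw.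
  have Iw : I11 w by apply: sub; move: hw; rewrite /= in_itv.
  have wd : `|w - z| < Num.min d (e / (C + 1)).
    near: w; rewrite near_simpl; under eq_near do rewrite distrC.
    by apply: cvgr_dist_lt => //; rewrite lt_min d0 divr_gt0// ltr_wpDl.
  move: wd; rewrite lt_min => /andP[wd we].
  have {}Hd := Hd _ Iw wd.
  suff : `|g w - g z| <= e by rewrite distrC.
  have -> : g w - g z = (g w - g z - g' z * (w - z)) + g' z * (w - z) by rewrite subrK.
  rewrite (le_trans (ler_normD _ _))// normrM.
  rewrite ltr_pdivlMr ?ltr_wpDl// in we.
  have := ler_wpM2r (normr_ge0 (w - z)) (HC z Iz).
  lra.
have [c + ->] := MVT xy der cont; rewrite in_itv/= => hc.
rewrite normrM (gtr0_norm (x := y - x)) ?subr_gt0// ler_wpM2r//.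
  by rewrite subr_ge0 ltW.
by apply: HC; apply: sub; lra.
Unshelve. all: by end_near. Qed.

Lemma lip_on_bound C h : 0 <= C -> lip_on C h -> exists2 B, C <= B &
  lip_on B h /\ forall x, I11 x -> `|h x| <= B.
Proof.
move=> C0 hL; have [_ [M hM]] := lip_on_bmeas hL.
have LB : C <= `|M| + C by rewrite lerDr.
exists (`|M| + C) => //; split; first exact: lip_onW hL.
by move=> x /hM hx; rewrite (le_trans hx)// (le_trans (ler_norm M))// lerDl.
Qed.

Lemma lip_on_min C h : lip_on C h -> (forall x, I11 x -> 0 < h x) ->
  exists2 m, 0 < m & forall x, I11 x -> m <= h x.
Proof.
move=> hL h0.
have N11 : (-1 : R) <= 1 by lra.
have ch : {within I11, continuous h}.
  apply/subspace_continuousP => x Ix; apply/cvgrPdist_le => e e0.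
  rewrite near_withinE; near=> y => Iy.
  rewrite (le_trans (hL x y Ix Iy))// (le_trans (ler_wpM2r _ (ler_norm C)))//.
  rewrite (@le_trans _ _ ((`|C| + 1) * `|x - y|))// ?ler_wpM2r ?lerDl//.
  rewrite -ler_pdivlMl; last by rewrite ltr_wpDl.
  by near: y; apply: cvgr_dist_le => //; rewrite mulr_gt0// invr_gt0 ltr_wpDl.
have [c + min] := EVT_min N11 ch; rewrite in_itv/= => hc.
by exists (h c); [apply: h0; rewrite I11E|move=> x Ix; exact: min].
Unshelve. all: by end_near. Qed.

(** The bounded-Lipschitz distance of rho and nu is at most e. *)
Definition close e rho nu := forall h, lip_on 1 h ->
  (forall x, I11 x -> `|h x| <= 1) -> `|integ rho h - integ nu h| <= e.

Lemma closeP e rho nu C h : close e rho nu -> 0 <= C -> lip_on C h ->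
  (forall x, I11 x -> `|h x| <= C) -> `|integ rho h - integ nu h| <= C * e.
Proof.
move=> cl; rewrite le_eqVlt => /predU1P[<- _ h0|C0 hL hB].
  have hE x : I11 x -> h x = cst 0 x.
    by move=> /h0; rewrite normr_le0 => /eqP.
  by rewrite !(eq_integ _ hE) !integ_cst !mul0r subrr normr0.
have bh := lip_on_bmeas hL.
have hE x : h x = C * (C^-1 * h x) by rewrite mulVKf// gt_eqF.
have bh' : bmeas (fun x => C^-1 * h x) by exact: bmeasZ.
rewrite !(eq_integ (k := fun x => C * (C^-1 * h x)) _ (fun x _ => hE x)).
rewrite !integZ// -mulrBr normrM (gtr0_norm C0) ler_pM2l// -!integZ//.
apply: cl => [x y Ix Iy|x Ix].
  rewrite -mulrBr normrM gtr0_norm ?invr_gt0// ler_pdivrMl// mul1r.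
  exact: hL.
by rewrite normrM gtr0_norm ?invr_gt0// ler_pdivrMl// mulr1 hB.
Qed.

Lemma close_tot e rho nu : close e rho nu -> `|tot rho - tot nu| <= e.
Proof.
move=> /(_ (cst 1)); rewrite !integ_cst !mul1r; apply => [x y _ _|x _].
  by rewrite subrr normr0 mul1r.
by rewrite normr1.
Qed.

Definition kernel_bound C q := [/\ 0 <= C, lip_on C q &
  forall x, I11 x -> `|q x| <= C].

Lemma C1_kernel_bound g b : C1_on_I11 g ->
  exists C, kernel_bound C g /\ kernel_bound C (fun z => g z + b).
Proof.
move=> /C1_lipschitz[C0 C00 gL]; have [C CC [gL' gB]] := lip_on_bound C00 gL.
have CB : C <= C + `|b| by rewrite lerDl.
have C_ge0 := le_trans C00 CC.
exists (C + `|b|); split; split; rewrite ?addr_ge0//.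
- exact: lip_onW gL'.
- by move=> x /gB hx; rewrite (le_trans hx).
- move=> x y Ix Iy; rewrite opprD addrACA subrr addr0.
  exact: (lip_onW CB gL').
- by move=> x /gB hx; rewrite (le_trans (ler_normD _ _))// lerD2r.
Qed.

Section fixed_kernel.
Variables (C : R) (q : R -> R).
Hypothesis qC : kernel_bound C q.

Lemma kernel_slice x : I11 x -> lip_on C (fun y => q (x * y)).
Proof.
have [C0 qL qB] := qC.
move=> Ix y z Iy Iz; rewrite (le_trans (qL _ _ (I11M Ix Iy) (I11M Ix Iz)))//.
rewrite ler_wpM2l// -mulrBr normrM ler_piMl//.
by move: Ix; rewrite I11E ler_norml.
Qed.

Lemma kernel_slice_bmeas x : I11 x -> bmeas (fun y => q (x * y)).
Proof. by move=> Ix; exact: lip_on_bmeas (kernel_slice Ix). Qed.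

(** This is Gfun q, for finite measures that need not be packed as Mplus. *)
Definition pot m (x : R) : R := integ m (fun y => q (x * y)).

Lemma pot_bound m x : I11 x -> `|pot m x| <= C * tot m.
Proof.
have [C0 qL qB] := qC.
move=> Ix; apply: ler_norm_integ; first exact: kernel_slice_bmeas.
by move=> y Iy; apply: qB; exact: I11M.
Qed.

Lemma pot_lip m : lip_on (C * tot m) (pot m).
Proof.
have [C0 qL qB] := qC.
move=> x x' Ix Ix'; rewrite /pot -integB; [|exact: kernel_slice_bmeas..].
rewrite mulrAC; apply: ler_norm_integ; first by apply: bmeasB; exact: kernel_slice_bmeas.
move=> y Iy; rewrite (le_trans (qL _ _ (I11M Ix Iy) (I11M Ix' Iy)))//.
rewrite ler_wpM2l// -mulrBl normrM ler_piMr//.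
by move: Iy; rewrite I11E ler_norml.
Qed.

Lemma pot_bmeas m : bmeas (pot m).
Proof. exact: lip_on_bmeas (pot_lip m). Qed.

Definition energy m : R := integ m (pot m).

Lemma pot_close e rho nu x : close e rho nu -> I11 x ->
  `|pot rho x - pot nu x| <= C * e.
Proof.
have [C0 qL qB] := qC.
move=> cl Ix; apply: closeP => //; first exact: kernel_slice.
by move=> y Iy; apply: qB; exact: I11M.
Qed.

(** Change one of the two measures in the double integral at a time. *)
Lemma energy_close e rho nu : close e rho nu ->
  `|energy rho - energy nu| <= C * e * (tot rho + tot nu).
Proof.
have [C0 qL qB] := qC.
move=> cl; have br := pot_bmeas rho; have bn := pot_bmeas nu.
rewrite /energy.
rewrite (_ : _ - _ = integ rho (fun x => pot rho x - pot nu x)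
    + (integ rho (pot nu) - integ nu (pot nu))); last by rewrite integB//; ring.
rewrite (le_trans (ler_normD _ _))// mulrDr lerD//.
  apply: ler_norm_integ; first exact: bmeasB.
  by move=> x Ix; exact: pot_close.
rewrite mulrAC; apply: closeP => //.
- by rewrite mulr_ge0// tot_ge0.
- exact: pot_lip.
- by move=> x; exact: pot_bound.
Qed.

End fixed_kernel.
End kernels.

(** * Normed spaces and finite-dimensional vectors *)

Lemma near_norm (R : realType) (E : normedModType R) (p : E) (P : set E) :
  (\forall q \near p, P q) <-> exists2 r, 0 < r & forall q, `|p - q| < r -> P q.
Proof. by split => [/nbhs_normP[r r0 H]|[r r0 H]]; [exists r|apply/nbhs_normP; exists r]. Qed.

Lemma lipschitz_continuous (R : realType) (E : normedModType R) (h : E -> R) C :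
  (forall x y, `|h x - h y| <= C * `|x - y|) -> continuous h.
Proof.
move=> hC x; apply/cvgrPdist_le => e e0; near=> y.
rewrite (le_trans (hC _ _))//.
rewrite (@le_trans _ _ ((`|C| + 1) * `|x - y|))//.
  by rewrite ler_wpM2r// (le_trans (ler_norm C))// lerDl.
rewrite -ler_pdivlMl; last by rewrite ltr_wpDl.
by near: y; apply: cvgr_dist_le => //; rewrite mulr_gt0// invr_gt0 ltr_wpDl.
Unshelve. all: by end_near. Qed.

Lemma continuous_sumr (R : realType) (T : topologicalType) (I : Type) (r : seq I) (F : I -> T -> R) :
  (forall i, continuous (F i)) -> continuous (fun x => \sum_(i <- r) F i x).
Proof.
move=> cF; elim: r => [|i r ih] x.
  by under eq_fun do rewrite big_nil; exact: cvg_cst.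
under eq_fun do rewrite big_cons.
by apply: cvgD; [exact: cF|exact: ih].
Qed.

Section euclidean_facts.
Context {R : realType} {d : nat}.
Local Notation V := 'cV[R]_d.
Implicit Types (x y z : V) (h : V -> R).

Lemma dot_continuous (T : topologicalType) (f g : T -> V) :
  (forall k, continuous (fun p => f p k 0)) ->
  (forall k, continuous (fun p => g p k 0)) ->
  continuous (fun p => dot (f p) (g p)).
Proof. by move=> cf cg; apply: continuous_sumr => k p; apply: cvgM; [exact: cf|exact: cg]. Qed.

Lemma dotDl x y z : dot (x + y) z = dot x z + dot y z.
Proof. by rewrite /dot -big_split/=; apply: eq_bigr => k _; rewrite mxE mulrDl. Qed.

Lemma dotZl c x y : dot (c *: x) y = c * dot x y.
Proof. by rewrite /dot mulr_sumr; apply: eq_bigr => k _; rewrite mxE mulrA. Qed.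

Lemma dotC x y : dot x y = dot y x.
Proof. by apply: eq_bigr => k _; rewrite mulrC. Qed.

Lemma dotDr x y z : dot z (x + y) = dot z x + dot z y.
Proof. by rewrite dotC dotDl !(dotC z). Qed.

Lemma dotZr c x y : dot y (c *: x) = c * dot y x.
Proof. by rewrite dotC dotZl dotC. Qed.

Lemma dot_delta y k : dot (delta_mx k 0) y = y k 0.
Proof.
rewrite /dot (bigD1 k)//= mxE !eqxx mul1r big1 ?addr0// => i ik.
by rewrite mxE (negbTE ik) mul0r.
Qed.

Lemma norm1_ge0 x : 0 <= norm1 x.
Proof. by rewrite mulr_ge0 ?invr_ge0// sumr_ge0. Qed.

Lemma norm1D x y : norm1 (x + y) <= norm1 x + norm1 y.
Proof.
rewrite /norm1 -mulrDr ler_wpM2l ?invr_ge0// -big_split/=.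
by apply: ler_sum => k _; rewrite mxE ler_normD.
Qed.

Lemma norm1Z c x : norm1 (c *: x) = `|c| * norm1 x.
Proof.
rewrite /norm1 mulrCA; congr (_ * _); rewrite mulr_sumr.
by apply: eq_bigr => k _; rewrite mxE normrM.
Qed.

Lemma norm10 : norm1 (0 : V) = 0.
Proof. by rewrite -(scale0r (0 : V)) norm1Z normr0 mul0r. Qed.

Lemma norm1N x : norm1 (- x) = norm1 x.
Proof. by rewrite -scaleN1r norm1Z normrN1 mul1r. Qed.

Lemma norm1B x y : norm1 (x - y) = norm1 (y - x).
Proof. by rewrite -norm1N opprB. Qed.

Lemma norm1_nneg x : nonneg x -> norm1 x = d%:R^-1 * \sum_k x k 0.
Proof. by move=> x0; congr (_ * _); apply: eq_bigr => k _; rewrite ger0_norm. Qed.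

Lemma norm1_delta c (k : 'I_d) : norm1 (c *: delta_mx k 0 : V) = d%:R^-1 * `|c|.
Proof.
rewrite norm1Z mulrC /norm1 (bigD1 k)//= mxE !eqxx normr1 big1 ?addr0 ?mulr1// => i ik.
by rewrite mxE (negbTE ik) normr0.
Qed.

Lemma coord_le_norm x k : `|x k 0| <= `|x|.
Proof.
rewrite [leRHS]/Num.Def.normr /= mx_normrE; apply/bigmax_geP; right => /=.
by exists (k, ord0) => //=; rewrite ord1.
Qed.

Lemma norm1_le_norm x : norm1 x <= `|x|.
Proof.
rewrite /norm1; have [d0|d0] := posnP d.
  have -> : d%:R^-1 = 0 :> R by rewrite d0 invr0.
  by rewrite mul0r.
rewrite ler_pdivrMl ?ltr0n// mulr_natl.
have -> : `|x| *+ d = \sum_(k < d) `|x| by rewrite sumr_const card_ord.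
by apply: ler_sum => k _; exact: coord_le_norm.
Qed.

Lemma coord_le_norm1 x k : `|x k 0| <= d%:R * norm1 x.
Proof.
have d0 : (0 < d)%N by case: d k => // -[].
rewrite /norm1 mulrA mulfV ?mul1r; last by rewrite pnatr_eq0 -lt0n.
by rewrite (bigD1 k)//= lerDl sumr_ge0.
Qed.

Lemma norm1_gt0 x y : x <> y -> 0 < norm1 (x - y).
Proof.
move=> xy; rewrite lt_neqAle norm1_ge0 andbT eq_sym; apply/eqP => n0; apply: xy.
apply/eqP; rewrite -subr_eq0; apply/eqP/matrixP => i j; rewrite ord1 [RHS]mxE.
by apply/eqP; rewrite -normr_le0 (le_trans (coord_le_norm1 _ _))// n0 mulr0.
Qed.

Lemma norm1s_ge0 y : 0 <= norm1s y.
Proof. exact: bigmax_ge_id. Qed.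

Lemma coord_le_norm1s y k : d%:R * `|y k 0| <= norm1s y.
Proof. by apply/bigmax_geP; right; exists k. Qed.

Lemma norm1s_le y c : 0 <= c -> (forall k, d%:R * `|y k 0| <= c) -> norm1s y <= c.
Proof. by move=> c0 h; apply: bigmax_le. Qed.

(** The normalized norms norm1 and norm1s are dual to each other. *)
Lemma dot_le x y : `|dot x y| <= norm1 x * norm1s y.
Proof.
rewrite /dot (le_trans (ler_norm_sum _ _ _))// /norm1 mulrAC mulrC mulr_suml.
apply: ler_sum => k _; rewrite normrM ler_wpM2l//.
have d0 : (0 < d)%N by case: d k => // -[].
by rewrite ler_pdivlMl ?ltr0n// coord_le_norm1s.
Qed.

Lemma nonnegD x y : nonneg x -> nonneg y -> nonneg (x + y).
Proof. by move=> hx hy k; rewrite mxE addr_ge0. Qed.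

Lemma nonnegZ c x : 0 <= c -> nonneg x -> nonneg (c *: x).
Proof. by move=> c0 hx k; rewrite mxE mulr_ge0. Qed.

Lemma nonneg_delta k : nonneg (delta_mx k 0 : V).
Proof. by move=> i; rewrite mxE ler0n. Qed.

Definition ball_pos (M : R) : set V := [set z | nonneg z /\ norm1 z <= M].

Lemma ball_pos_compact M : compact (ball_pos M).
Proof.
pose K := d%:R * M.
pose B : set 'rV[R]_d := [set v | forall i, `[- K, K]%classic (v ord0 i)].
have cB : compact B by apply: (@rV_compact R d (fun=> `[- K, K]%classic)) => i; exact: segment_compact.
have ctr : continuous (fun v : 'rV[R]_d => v^T : V).
  move=> v A /= /(nbhs_ballP (v^T)) [e e0 eA].
  apply/nbhs_ballP; exists e => //= w [_ vw]; apply: eA; split=> // i j.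
  by rewrite !mxE; exact: vw.
have cB' : compact ((fun v : 'rV[R]_d => v^T : V) @` B).
  by apply: continuous_compact => //; exact: continuous_subspaceT.
apply: subclosed_compact cB' _.
  rewrite [X in closed X](_ : _ = (\bigcap_(k in [set: 'I_d]) [set z : V | 0 <= z k 0]) `&` [set z : V | norm1 z <= M]).
    apply: closedI; first apply: closed_bigI => k _.
      by apply: (@closed_comp _ _ (fun z : V => z k 0) [set r | 0 <= r]) => [x _|]; [exact: coord_continuous|exact: closed_ge].
    apply: (@closed_comp _ _ (fun z : V => norm1 z) [set r | r <= M]) => [x _|]; last exact: closed_le.
    apply: (@lipschitz_continuous R V _ 1) => y z; rewrite mul1r.
    rewrite (le_trans _ (norm1_le_norm _))// ler_norml.
    have := norm1D (y - z) z; have := norm1D (z - y) y; rewrite !subrK norm1B.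
    by lra.
  apply/seteqP; split => z /=.
    by move=> [z0 zM]; split => // k _; exact: z0.
  by move=> [z0 zM]; split => // k; exact: z0.
move=> z [z0 zM]; exists z^T; last by rewrite trmxK.
move=> i; rewrite mxE /= in_itv/= -ler_norml (le_trans (coord_le_norm1 _ _))//.
by rewrite ler_wpM2l.
Qed.

Lemma ball_pos_convex M z w s : ball_pos M z -> ball_pos M w -> 0 <= s -> s <= 1 ->
  ball_pos M (s *: z + (1 - s) *: w).
Proof.
move=> [z0 zM] [w0 wM] s0 s1; have s1' : 0 <= 1 - s by rewrite subr_ge0.
split; first by apply: nonnegD; exact: nonnegZ.
rewrite (le_trans (norm1D _ _))// !norm1Z !ger0_norm//.
rewrite (le_trans (lerD (ler_wpM2l s0 zM) (ler_wpM2l s1' wM)))//.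
by rewrite -mulrDl addrCA subrr addr0 mul1r.
Qed.

End euclidean_facts.

(** * First-order expansions *)

Section derivatives.
Context {R : realType} {E : normedModType R}.
Implicit Types (phi : E -> R) (p v w : E).

(** Only increments h > 0 are considered, so that directions can be added with
nonnegative coefficients. *)
Definition expands phi p v (l : R) := forall e, 0 < e -> exists2 r, 0 < r &
  forall h, 0 < h -> h < r -> `|phi (p + h *: v) - phi p - h * l| <= e * h.

Lemma derivable_quotient phi p v : derivable phi p v ->
  forall e, 0 < e -> exists2 r, 0 < r & forall h, `|h| < r ->
    `|phi (p + h *: v) - phi p - h * 'D_v phi p| <= e * `|h|.
Proof.
move=> dphi e e0.
have /cvgrPdist_le /(_ e e0) : h^-1 *: (phi (h *: v + p) - phi p) @[h --> (0:R)^'] --> 'D_v phi p.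
  exact: dphi.
rewrite /dnbhs /within /= => /nbhs_ballP[r /= r0 Hr].
exists r => // h hr; have [->|h0] := eqVneq h 0.
  by rewrite scale0r addr0 subrr mul0r subrr normr0 mulr0.
have := Hr h; rewrite /ball/= sub0r normrN => /(_ hr h0).
rewrite [h *: v + p]addrC => H.
have -> : phi (p + h *: v) - phi p - h * 'D_v phi p =
  - ('D_v phi p - h^-1 * (phi (p + h *: v) - phi p)) * h by field.
by rewrite normrM normrN ler_wpM2r//; exact: H.
Qed.

Lemma derivable_expandsN phi p v : derivable phi p v -> expands phi p (- v) (- 'D_v phi p).
Proof.
move=> /derivable_quotient H e e0; have [r r0 Hr] := H e e0.
exists r => // h h0 hr; have := Hr (- h); rewrite normrN gtr0_norm// => /(_ hr).
by rewrite scaleNr scalerN mulNr mulrN.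
Qed.

Lemma mean_value_line phi p v s : 0 < s ->
  (forall r, 0 <= r <= s -> derivable phi (p + r *: v) v) ->
  exists2 r, 0 <= r <= s & phi (p + s *: v) - phi p = s * 'D_v phi (p + r *: v).
Proof.
move=> s0 H; pose f r := phi (p + r *: v).
have fE r : (fun h : R => h^-1 *: ((f \o shift r) (h *: (1 : R)) - f r)) =
    (fun h => h^-1 *: ((phi \o shift (p + r *: v)) (h *: v) - phi (p + r *: v))).
  apply/funext => h; rewrite /f /= (_ : h *: (1 : R) = h); last exact: mulr1.
  congr (_ *: (phi _ - _)).
  by rewrite scalerDl addrCA.
have df r : 0 <= r <= s -> is_derive r (1 : R) f ('D_v phi (p + r *: v)).
  move=> rs; have Hr := H r rs.
  by apply: DeriveDef; [rewrite /derivable fE; exact: Hr|rewrite /derive fE].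
have cf : {within `[0, s], continuous f}.
  apply: derivable_within_continuous => r; rewrite in_itv/= => rs.
  by have [] := df r rs.
have df' r : r \in `]0, s[%R -> is_derive r (1 : R) f ('D_v phi (p + r *: v)).
  by rewrite in_itv/= => /andP[r0 rs]; apply: df; rewrite !ltW.
have [c] := MVT s0 df' cf.
rewrite in_itv/= => /andP[c0 cs]; rewrite /f scale0r addr0 subr0 => fc.
by exists c; [rewrite !ltW|rewrite fc mulrC].
Qed.

(** Continuity of the derivative in the direction v near p makes the increment
along c v uniform in the base point p + h u; a two-step path then gives the
additivity of the expansion, without total differentiability. *)
Lemma expandsD phi p u v l c (U : set E) : 0 <= c -> nbhs p U ->
  (forall q, U q -> derivable phi q v) -> {for p, continuous ('D_v phi)} ->
  expands phi p u l -> expands phi p (u + c *: v) (l + c * 'D_v phi p).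
Proof.
rewrite le_eqVlt => /predU1P[<- _ _ _|c0 Up dphi cphi exu].
  by rewrite scale0r addr0 mul0r addr0.
move=> e e0; have e2 : 0 < e / 2 by rewrite divr_gt0.
have [r1 r10 H1] := exu _ e2.
have e2c : 0 < e / (2 * c) by rewrite divr_gt0// mulr_gt0.
have : \forall q \near p, U q /\ `|'D_v phi p - 'D_v phi q| <= e / (2 * c).
  by apply: filterI => //; exact: cvgr_dist_le cphi _ e2c.
move=> /nbhs_normP[r2 /= r20 H2].
pose r3 := r2 / (`|u| + c * `|v| + 1).
have den : 0 < `|u| + c * `|v| + 1 by rewrite ltr_wpDl// addr_ge0// mulr_ge0// ltW.
exists (Num.min r1 r3); first by rewrite lt_min r10 divr_gt0.
move=> h h0; rewrite lt_min => /andP[hr1 hr3].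
have near r : 0 <= r <= h * c -> ball_ (fun x => `|x|) p r2 (p + h *: u + r *: v).
  move=> /andP[r0 rh]; rewrite /= -addrA opprD addrA subrr add0r normrN.
  rewrite (le_lt_trans (ler_normD _ _))// !normrZ (gtr0_norm h0) (ger0_norm r0).
  move: hr3; rewrite ltr_pdivlMr// => hr3.
  by have := ler_wpM2r (normr_ge0 v) rh; lra.
have hc0 : 0 < h * c by rewrite mulr_gt0.
have [r rhc] := @mean_value_line phi (p + h *: u) v _ hc0 (fun r hr => dphi _ (H2 _ (near r hr)).1).
rewrite -addrA -scalerA -scalerDr => E2.
have := (H2 _ (near r rhc)).2; have := H1 h h0 hr1.
rewrite (_ : phi (p + h *: (u + c *: v)) - phi p - h * (l + c * 'D_v phi p) =
  (phi (p + h *: u) - phi p - h * l) +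
   (- (h * c)) * ('D_v phi p - 'D_v phi (p + h *: u + r *: v))); last first.
  by rewrite -[phi (p + h *: (u + c *: v))](subrK (phi (p + h *: u))) E2; ring.
move=> B1 B2; rewrite (le_trans (ler_normD _ _))// normrM normrN (gtr0_norm hc0).
have := ler_wpM2l (ltW hc0) B2.
have -> : h * c * (e / (2 * c)) = e / 2 * h by field; rewrite gt_eqF.
by lra.
Qed.

End derivatives.

(** * The Hopf-Lax viscosity solution *)

Section hopf_lax.
Context {R : realType} {d : nat}.
Local Notation V := 'cV[R]_d.
Variables (psi En : V -> R) (L M : R) (H : V -> R).
Hypotheses (L0 : 0 <= L) (M0 : 0 <= M).
Hypothesis psiL : forall x y, `|psi x - psi y| <= L * norm1 (x - y).
Hypothesis En_cont : continuous En.
Hypothesis En_convex : forall z w s, ball_pos M z -> ball_pos M w -> 0 <= s -> s <= 1 ->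
  En (s *: z + (1 - s) *: w) <= s * En z + (1 - s) * En w.
Hypothesis H_ge : forall y z, ball_pos M z -> dot z y - En z <= H y.
Hypothesis H_le : forall y, norm1s y <= L ->
  exists2 z, ball_pos M z & H y <= dot z y - En z.

Definition hopf (t : R) (x : V) : R :=
  sup [set psi (x + t *: z) - t * En z | z in ball_pos M].

Lemma ball_pos0 : ball_pos M (0 : V).
Proof.
split=> [k|]; first by rewrite mxE.
by rewrite norm10.
Qed.

Lemma psi_continuous : continuous psi.
Proof.
apply: (@lipschitz_continuous R V _ L) => x y.
by rewrite (le_trans (psiL x y))// ler_wpM2l// norm1_le_norm.
Qed.

Lemma hopf_max t x : exists z, [/\ ball_pos M z,
  hopf t x = psi (x + t *: z) - t * En z &
  forall w, ball_pos M w -> psi (x + t *: w) - t * En w <= hopf t x].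
Proof.
pose f z := psi (x + t *: z) - t * En z.
have cf : continuous f.
  move=> z.
  have cE : {for z, continuous (fun z : V => t * En z)}.
    by apply: continuousM; [exact: cst_continuous|exact: En_cont].
  have cl : {for z, continuous (fun z : V => x + t *: z)}.
    by apply: continuousD; [exact: cst_continuous|exact: scaler_continuous].
  exact: cvgB (continuous_comp cl (@psi_continuous _)) cE.
have [z /set_mem Mz zmax] := compact_EVT_max (ex_intro _ _ ball_pos0)
  (@ball_pos_compact R d M) (continuous_subspaceT cf).
have {}zmax w : ball_pos M w -> f w <= f z by move=> /mem_set; exact: zmax.
have hE : hopf t x = f z.
  apply/le_anti/andP; split.
    apply: ge_sup; first by exists (f z); exists z.
    by move=> _ [w Mw <-]; exact: zmax.
  apply: ub_le_sup; last by exists z.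
  by exists (f z) => _ [w Mw <-]; exact: zmax.
by exists z; split => // w Mw; rewrite hE; exact: zmax.
Qed.

Lemma hopf_ge t x w : ball_pos M w -> psi (x + t *: w) - t * En w <= hopf t x.
Proof. by move=> Mw; have [z [_ _]] := hopf_max t x; exact. Qed.

Lemma hopf0 x : hopf 0 x = psi x.
Proof. by have [z [_ -> _]] := hopf_max 0 x; rewrite scale0r addr0 mul0r subr0. Qed.

Lemma En_bound : exists2 B, 0 <= B & forall z, ball_pos M z -> `|En z| <= B.
Proof.
have cE := continuous_subspaceT (A := ball_pos M) En_cont.
have [z1 _ h1] := compact_EVT_max (ex_intro _ _ ball_pos0) (@ball_pos_compact R d M) cE.
have [z2 _ h2] := compact_EVT_min (ex_intro _ _ ball_pos0) (@ball_pos_compact R d M) cE.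
exists (`|En z1| + `|En z2|); first by rewrite addr_ge0.
move=> z /mem_set Mz; have := h1 z Mz; have := h2 z Mz.
have := ler_norm (En z1); have := ler_norm (- En z2); rewrite normrN.
have := normr_ge0 (En z1); have := normr_ge0 (En z2).
by move=> ? ? ? ? ? ?; rewrite ler_norml; apply/andP; split; lra.
Qed.

Lemma hopf_dist : exists2 B, 0 <= B & forall t x t' x',
  `|hopf t x - hopf t' x'| <= L * norm1 (x - x') + B * `|t - t'|.
Proof.
have [B B0 EB] := En_bound; exists (L * M + B); first by rewrite addr_ge0 ?mulr_ge0.
suff main t x t' x' : hopf t x - hopf t' x' <= L * norm1 (x - x') + (L * M + B) * `|t - t'|.
  move=> t x t' x'; rewrite ler_norml; apply/andP; split; last exact: main.
  by rewrite lerNl opprB norm1B distrC; exact: main.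
have [z [Mz -> _]] := hopf_max t x.
have := hopf_ge t' x' Mz.
have := psiL (x + t *: z) (x' + t' *: z).
rewrite opprD addrACA -scalerBl => /(le_trans (ler_norm _)) h1 h2.
have h3 : L * norm1 (x - x' + (t - t') *: z) <= L * (norm1 (x - x') + `|t - t'| * M).
  rewrite ler_wpM2l// (le_trans (norm1D _ _))// lerD2l norm1Z ler_wpM2l//.
  by case: Mz.
have h4 : - (t - t') * En z <= `|t - t'| * B.
  by rewrite (le_trans (ler_norm _))// normrM normrN ler_wpM2l// EB.
by lra.
Qed.

Lemma hopf_Lipx t x x' : `|hopf t x - hopf t x'| <= L * norm1 (x - x').
Proof.
have [B _ /(_ t x t x')] := hopf_dist.
by rewrite subrr normr0 mulr0 addr0.
Qed.

(** Going along z for a time s and then along w for a time t - s costs at least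
as much as going along their average for a time t, by convexity of En. *)
Lemma hopf_dpp_ge t s x z : 0 < s -> s < t -> ball_pos M z ->
  hopf (t - s) (x + s *: z) - s * En z <= hopf t x.
Proof.
move=> s0 st Mz; have t0 : 0 < t by exact: lt_trans st.
have [w [Mw -> _]] := hopf_max (t - s) (x + s *: z).
pose r := s / t.
have r0 : 0 <= r by rewrite divr_ge0// ltW.
have r1 : r <= 1 by rewrite ler_pdivrMr// mul1r ltW.
have Mrw := ball_pos_convex Mz Mw r0 r1.
have := hopf_ge t x Mrw.
have tr : t * r = s by rewrite /r mulrC divfK// gt_eqF.
have -> : x + t *: (r *: z + (1 - r) *: w) = x + s *: z + (t - s) *: w.
  by rewrite scalerDr !scalerA mulrBr tr mulr1 addrA.
have := ler_wpM2l (ltW t0) (En_convex Mz Mw r0 r1).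
have -> : t * (r * En z + (1 - r) * En w) = s * En z + (t - s) * En w.
  by rewrite -tr; ring.
move=> h1 h2.
by rewrite (le_trans _ h2)//; lra.
Qed.

(** The maximizer z from (t, x) can be kept for the remaining time; the same z
serves for all s, which gives touching_sub a fixed direction. *)
Lemma hopf_dpp_le t x : exists2 z, ball_pos M z &
  forall s, 0 < s -> hopf t x <= hopf (t - s) (x + s *: z) - s * En z.
Proof.
have [z [Mz -> _]] := hopf_max t x; exists z => // s s0.
have := hopf_ge (t - s) (x + s *: z) Mz.
by rewrite -addrA -scalerDl addrCA subrr addr0; lra.
Qed.

Lemma open_domain_nbhs (p : R * V) : open_domain p -> nbhs p (open_domain (R := R) (d := d)).
Proof.
move=> [p1 p2].
have [r r0 Hr] : exists2 r, 0 < r & r <= p.1 /\ forall k, r <= p.2 k 0.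
  exists (\big[Num.min/p.1]_k p.2 k 0); last split.
  - by apply/bigmin_gtP; split.
  - exact: bigmin_le_id.
  - by move=> k; exact: bigmin_le_cond.
apply/(@near_norm R (R * V)%type); exists r => // -[t x] hn.
have /andP[h1 h2] : (`|p.1 - t| < r) && (`|p.2 - x| < r).
  by move: hn; rewrite [X in X < _]/Num.Def.normr/= gt_max.
split => /=.
  by have := ltr_normlW h1; case: Hr => ? _; lra.
move=> k; have := coord_le_norm (p.2 - x) k; rewrite !mxE.
by have := ler_norm (p.2 k 0 - x k 0); case: Hr => _ /(_ k); lra.
Qed.

Section touching.
Variables (phi : R * V -> R) (t : R) (x : V).
Hypotheses (phi_smooth : smooth (open_domain (R := R) (d := d)) phi).
Hypothesis p_open : open_domain (t, x).
Let p : R * V := (t, x).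

Let phi_C1 (v : R * V) : (forall q, open_domain q -> derivable phi q v) /\
  {for p, continuous ('D_v phi)}.
Proof.
have [_ /(_ v) [h1 [h2 _]]] := phi_smooth 1%N.
by split => //; exact: h2.
Qed.

(** The direction (-1, z) is reached from (-1, 0) by adding the coordinate
directions with the nonnegative coefficients z_k. *)
Lemma expands_characteristic z : nonneg z ->
  expands phi p (- 1, z) (- dt phi p + dot z (dx phi p)).
Proof.
move=> z0.
(* Decompose z along the coordinate vectors; the expansion is then built by
   induction on the list of coordinates. *)
have sumE : z = \sum_k z k 0 *: delta_mx k 0.
  apply/matrixP => i j; rewrite ord1 summxE (bigD1 i)//= !mxE !eqxx mulr1 big1 ?addr0// => k ki.
  by rewrite !mxE eq_sym (negbTE ki) mulr0.
suff main (r : seq 'I_d) : expands phi p (- 1, \sum_(k <- r) z k 0 *: delta_mx k 0)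
    (- dt phi p + \sum_(k <- r) z k 0 * dx phi p k 0).
  by rewrite [X in (_, X)]sumE; exact: main.
elim: r => [|k r ih].
  rewrite !big_nil addr0 (_ : (-1, 0) = - ((1, 0) : R * V)); last first.
    by congr pair; rewrite oppr0.
  by apply: derivable_expandsN; exact: (phi_C1 _).1.
rewrite !big_cons addrCA addrC [X in (_, X)]addrC mxE.
have -> : ((- 1, \sum_(j <- r) z j 0 *: delta_mx j 0 + z k 0 *: delta_mx k 0) : R * V) =
    (-1, \sum_(j <- r) z j 0 *: delta_mx j 0) + z k 0 *: ((0, delta_mx k 0) : R * V).
  by congr pair; rewrite /= scaler0 addr0.
apply: (expandsD (z0 k) (open_domain_nbhs p_open) _ _ ih).
- exact: (phi_C1 _).1.
- exact: (phi_C1 _).2.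
Qed.

(** Backwards in time along the characteristic of the maximizer z, hopf grows at
a rate of at least En z, hence so does phi, which touches it from above. *)
Lemma touching_sub :
  (\forall q \near p, hopf q.1 q.2 - phi q <= hopf p.1 p.2 - phi p) ->
  dt phi p - H (dx phi p) <= 0.
Proof.
move=> /(@near_norm R (R * V)%type)[r r0 Hr].
have [z Mz zmax] := hopf_dpp_le t x.
suff : En z <= - dt phi p + dot z (dx phi p).
  by have := H_ge (dx phi p) Mz; lra.
apply/ler_addgt0Pr => e e0.
have [r1 r10 H1] := expands_characteristic Mz.1 e0.
pose v : R * V := (-1, z).
pose h := Num.min (r1 / 2) (r / (2 * (`|v| + 1))).
have v1 : 0 < `|v| + 1 by rewrite ltr_wpDl.
have h0 : 0 < h by rewrite lt_min !divr_gt0// mulr_gt0.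
have hr1 : h < r1.
  by rewrite (@le_lt_trans _ _ (r1 / 2))// ?ge_min ?lexx//; lra.
have hr : `|h *: v| < r.
  rewrite normrZ gtr0_norm//.
  have : h <= r / (2 * (`|v| + 1)) by rewrite /h ge_min lexx orbT.
  by rewrite ler_pdivlMr ?mulr_gt0//; have := normr_ge0 v; nra.
have Hq : hopf (t - h) (x + h *: z) - phi (p + h *: v) <= hopf t x - phi p.
  have := Hr (p + h *: v); rewrite opprD addrA subrr add0r normrN => /(_ hr) /=.
  by rewrite [h *: -1]mulrN mulr1.
have := H1 h h0 hr1; rewrite ler_norml => /andP[_].
have := zmax h h0 => Z1 Z2.
rewrite -(ler_pM2l h0); lra.
Qed.

(** A function that touches an L-Lipschitz function from below at an interior
point has all its slopes bounded by L. *)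
Lemma touching_gradient :
  (\forall q \near p, hopf q.1 q.2 - phi q >= hopf p.1 p.2 - phi p) ->
  norm1s (dx phi p) <= L.
Proof.
move=> /(@near_norm R (R * V)%type)[r r0 Hr].
apply: norm1s_le => // k; have d0 : (0 < d)%N by case: d k => // -[].
rewrite -ler_pdivlMl ?ltr0n// mxE; apply/ler_addgt0Pr => e e0.
pose v : R * V := (0, delta_mx k 0).
have [r1 r10 H1] := derivable_quotient ((phi_C1 v).1 _ p_open) e0.
pose h := Num.min (r1 / 2) (r / (2 * (`|v| + 1))).
have v1 : 0 < `|v| + 1 by rewrite ltr_wpDl.
have h0 : 0 < h by rewrite lt_min !divr_gt0// mulr_gt0.
have hr1 : h < r1.
  by rewrite (@le_lt_trans _ _ (r1 / 2))// ?ge_min ?lexx//; lra.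
have hr : h * `|v| < r.
  have : h <= r / (2 * (`|v| + 1)) by rewrite /h ge_min lexx orbT.
  by rewrite ler_pdivlMr ?mulr_gt0//; have := normr_ge0 v; nra.
have side s : `|s| = h -> s * 'D_v phi p <= (d%:R^-1 * L + e) * h.
  move=> sh; have := H1 s; rewrite sh => /(_ hr1).
  rewrite ler_norml => /andP[B1 _].
  have Hq : hopf t x - phi p <= hopf t (x + s *: delta_mx k 0) - phi (p + s *: v).
    have := Hr (p + s *: v); rewrite opprD addrA subrr add0r normrN normrZ sh => /(_ hr) /=.
    by rewrite [s *: 0]mulr0 addr0.
  have := hopf_Lipx t (x + s *: delta_mx k 0) x.
  rewrite addrAC subrr add0r norm1_delta sh => /(le_trans (ler_norm _)).
  by lra.
rewrite -(ler_pM2r h0) -{1}(gtr0_norm h0) -normrM mulrC ler_norml; apply/andP; split.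
  have := side (- h); rewrite normrN gtr0_norm// => /(_ erefl); lra.
by apply: side; rewrite gtr0_norm.
Qed.

(** Backwards in time along any z in the ball, hopf grows at a rate of at most
En z; use the z for which En and H are conjugate at the gradient of phi.
Such a z exists because the gradient has size at most L. *)
Lemma touching_super :
  (\forall q \near p, hopf q.1 q.2 - phi q >= hopf p.1 p.2 - phi p) ->
  dt phi p - H (dx phi p) >= 0.
Proof.
move=> loc; have [z Mz Hz] := H_le (touching_gradient loc).
move: loc => /(@near_norm R (R * V)%type)[r r0 Hr].
suff : - dt phi p + dot z (dx phi p) <= En z by lra.
apply/ler_addgt0Pr => e e0.
have [r1 r10 H1] := expands_characteristic Mz.1 e0.
pose v : R * V := (-1, z).
have t0 : 0 < t by case: p_open.
pose h := Num.min (t / 2) (Num.min (r1 / 2) (r / (2 * (`|v| + 1)))).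
have v1 : 0 < `|v| + 1 by rewrite ltr_wpDl.
have h0 : 0 < h by rewrite !lt_min !divr_gt0// mulr_gt0.
have ht : h < t.
  by rewrite (@le_lt_trans _ _ (t / 2))// ?ge_min ?lexx//; lra.
have hr1 : h < r1.
  by rewrite (@le_lt_trans _ _ (r1 / 2))// ?ge_min ?lexx ?orbT//; lra.
have hr : `|h *: v| < r.
  rewrite normrZ gtr0_norm//.
  have : h <= r / (2 * (`|v| + 1)) by rewrite /h !ge_min lexx !orbT.
  by rewrite ler_pdivlMr ?mulr_gt0//; have := normr_ge0 v; nra.
have Hq : hopf t x - phi p <= hopf (t - h) (x + h *: z) - phi (p + h *: v).
  have := Hr (p + h *: v); rewrite opprD addrA subrr add0r normrN => /(_ hr) /=.
  by rewrite [h *: -1]mulrN mulr1.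
have := H1 h h0 hr1; rewrite ler_norml => /andP[+ _].
have := hopf_dpp_ge x h0 ht Mz => Z1 Z2.
rewrite -(ler_pM2l h0); lra.
Qed.

End touching.

Lemma hopf_solution : Lunif_solution H psi hopf.
Proof.
have [B B0 hB] := hopf_dist.
have lip t : (Lip1 (hopf t) <= L%:E)%E.
  apply: ge_ereal_sup => _ [x [x' [_ _ xx' ->]]]; rewrite lee_fin.
  by rewrite ler_pdivrMr ?norm1_gt0//; exact: hopf_Lipx.
split; last by move=> x _; exact: hopf0.
- split; first split.
  + by rewrite (le_lt_trans (lip 0))// ltry.
  + rewrite (@le_lt_trans _ _ B%:E)// ?ltry//.
    apply: ge_ereal_sup => _ [t [x [t0 _ ->]]]; rewrite lee_fin ler_pdivrMr//.
    have := hB t x 0 x; rewrite subrr subr0 (gtr0_norm t0).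
    by rewrite norm10 mulr0 add0r.
  + rewrite (@le_lt_trans _ _ L%:E)// ?ltry//.
    by apply: ge_ereal_sup => _ [t _ <-]; exact: lip.
- split.
    apply: continuous_subspaceT.
    apply: (@lipschitz_continuous R _ _ (L + B)) => p q.
    rewrite (le_trans (hB _ _ _ _))// mulrDl.
    have : `|p.1 - q.1| <= `|p - q| /\ `|p.2 - q.2| <= `|p - q|.
      by rewrite [`|p - q|]/Num.Def.normr/= !le_max !lexx orbT.
    move=> [h1 h2]; rewrite lerD ?ler_wpM2l//.
    exact: le_trans (norm1_le_norm _) h2.
  move=> phi phi_smooth [t x] p_open; split.
    exact: touching_sub.
  exact: touching_super.
Qed.

End hopf_lax.

(** * Atomic measures and discretization *)

Section atomic_measures.
Context {R : realType}.
Local Notation RM := (measurableTypeR R).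
Context (K : nat).
Local Notation dK := (2 ^ K.+1)%N.
Local Notation V := 'cV[R]_dK.
Implicit Types (x y z : V) (mu : Mplus R).

Lemma dK_gt0 : 0 < dK%:R :> R.
Proof. by rewrite ltr0n expn_gt0. Qed.

Lemma dK_half : dK%:R = 2 * 2 ^+ K :> R.
Proof. by rewrite natrX exprS. Qed.

Lemma dyadS (i : nat) : dyad K i.+1 = dyad K i + (2 ^+ K)^-1 :> R.
Proof. by rewrite /dyad -natr1 mulrDl mul1r addrAC. Qed.

Lemma dyad_le (i j : nat) : (i <= j)%N -> dyad K i <= dyad K j :> R.
Proof. by move=> ij; rewrite lerD2r ler_wpM2r ?invr_ge0 ?exprn_ge0// ler_nat. Qed.

Lemma dyad_last : dyad K dK = 1 :> R.
Proof. by rewrite /dyad dK_half mulfK ?expf_neq0//; lra. Qed.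

Lemma dyad_first : dyad K 0 = -1 :> R.
Proof. by rewrite /dyad mul0r sub0r. Qed.

Lemma dyad_I11 (i : nat) : (i <= dK)%N -> I11 (dyad K i : R).
Proof.
by move=> id; rewrite I11E -dyad_first -dyad_last !dyad_le.
Qed.

Lemma atomicE x (A : set RM) :
  atomic x A = (\sum_(k < dK) (Num.max (x k 0) 0 / dK%:R)%:E * \d_(dyad K k : RM) A)%E.
Proof. by []. Qed.

Lemma fine_atomic x (A : set RM) : measurable A ->
  fine (atomic x A) = \sum_(k < dK) Num.max (x k 0) 0 / dK%:R * \1_A (dyad K k : R).
Proof.
move=> mA; rewrite atomicE -sum_fine => [|k _]; last by rewrite diracE -EFinM.
by apply: eq_bigr => k _; rewrite diracE -EFinM.
Qed.

Lemma tot_atomic x : nonneg x -> tot (atomic x) = norm1 x.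
Proof.
move=> x0; rewrite /tot fine_atomic// norm1_nneg// mulr_sumr; apply: eq_bigr => k _.
rewrite indicE mem_set ?mulr1; last by apply: dyad_I11; exact: ltnW.
by rewrite (max_idPl (x0 k)) mulrC.
Qed.

Lemma integ_atomic x h : nonneg x -> bmeas h ->
  integ (atomic x) h = dK%:R^-1 * \sum_k x k 0 * h (dyad K k).
Proof.
move=> x0.
have pos h0 : bmeas h0 -> (forall s : R, I11 s -> 0 <= h0 s) ->
    integ (atomic x) h0 = dK%:R^-1 * \sum_k x k 0 * h0 (dyad K k).
  move=> bh h00.
  pose w (k : nat) : {nonneg R} := nneg_part (if insub k is Some i then x i 0 / dK%:R else 0).
  have hE : measurable_fun I11 (EFin \o h0) by apply/measurable_EFinP; case: bh.
  have h00' (y : R) : I11 y -> (0 <= (EFin \o h0) y)%E by move=> Iy; rewrite lee_fin h00.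
  rewrite /integ /Rintegral.
  rewrite (eq_measure_integral (msum (fun k => mscale (w k) (\d_(dyad K k : RM))) dK)).
    rewrite ge0_integral_measure_sum//.
    rewrite (eq_bigr (fun k : 'I_dK => (x k 0 / dK%:R * h0 (dyad K k))%:E)); last first.
      move=> k _; rewrite ge0_integral_mscale// integral_dirac//.
      rewrite diracE mem_set ?mul1e; last by apply: dyad_I11; exact: ltnW.
      by rewrite /w valK/= (max_idPl _) ?divr_ge0// EFinM.
    by rewrite sumEFin/= mulr_sumr; apply: eq_bigr => k _; ring.
  move=> A mA _; rewrite [LHS]atomicE; apply: eq_bigr => k _.
  rewrite /= /mscale/= valK/=; congr (_%:E * _)%E.
  by rewrite !(max_idPl _) ?divr_ge0.
move=> bh; have [mh [M hM]] := bh.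
have bM := bmeas_cst M.
have -> : integ (atomic x) h = integ (atomic x) (fun s => h s + cst M s) - M * tot (atomic x).
  by rewrite integD// integ_cst addrK.
rewrite pos; first last.
- by move=> y /hM; rewrite ler_norml /= => /andP[? _]; lra.
- exact: bmeasD.
rewrite tot_atomic// norm1_nneg// mulrCA -mulrBr; congr (_ * _).
rewrite mulr_sumr -sumrB; apply: eq_bigr => k _; rewrite /=; ring.
Qed.

Lemma atomic_dist x x' (A : set RM) : measurable A ->
  `|fine (atomic x A) - fine (atomic x' A)| <= norm1 (x - x').
Proof.
move=> mA; rewrite !fine_atomic// -sumrB (le_trans (ler_norm_sum _ _ _))//.
rewrite /norm1 mulr_sumr; apply: ler_sum => k _.
rewrite -mulrBl normrM -mulrBl normrM (@ger0_norm _ (dK%:R^-1)) ?invr_ge0// mxE mxE.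
have h1 : `|\1_A (dyad K k : R)| <= 1 :> R by rewrite indicE normr_nat lern1 leq_b1.
rewrite (le_trans (ler_wpM2l _ h1))// ?mulr_ge0 ?invr_ge0// mulr1 mulrC.
by rewrite ler_wpM2l ?invr_ge0// dist_max0.
Qed.

Lemma restr_fun_lip psi L : 0 <= L -> lipschitz_TV psi L -> forall x x' : V,
  `|restr_fun psi x - restr_fun psi x'| <= L * norm1 (x - x').
Proof.
by move=> L0 psiL x x'; apply: lipschitz_TV_dist => // A mA _; exact: atomic_dist.
Qed.

(** This turns the Hopf-Lax argument x + t z into a translation of measures. *)
Lemma atomic_translate x z (t : {nonneg R}) (A : set RM) : nonneg x -> nonneg z ->
  translate (atomic x) t (atomic z) A = atomic (x + t%:num *: z) A.
Proof.
move=> x0 z0; rewrite translateE !atomicE ge0_sume_distrr; last first.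
  by move=> k _; rewrite diracE -EFinM lee_fin mulr_ge0// divr_ge0// max0_ge0.
rewrite -big_split/=; apply: eq_bigr => k _; rewrite !mxE diracE.
rewrite !(max_idPl _)//; last by rewrite addr_ge0// mulr_ge0.
by rewrite -!EFinM -EFinD; congr EFin; ring.
Qed.

Lemma integ_pot_atomic C q x z : kernel_bound C q ->
  nonneg x -> nonneg z ->
  integ (atomic x) (pot q (atomic z)) = dot x (kmatrix K q *m z).
Proof.
move=> qC x0 z0; rewrite integ_atomic//; last exact: pot_bmeas qC _.
rewrite /dot mulr_sumr; apply: eq_bigr => k _; rewrite !mxE mulrCA; congr (_ * _).
rewrite /pot integ_atomic//; last first.
  by apply: (kernel_slice_bmeas qC); apply: dyad_I11; exact: ltnW.
rewrite mulrA mulr_sumr; apply: eq_bigr => j _; rewrite mxE.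
by rewrite expr2 invfM; ring.
Qed.

Definition step (h : R -> R) (s : R) : R :=
  \sum_(k < dK) h (dyad K k) * \1_(cell (R := R) k) s.

Lemma cellE (k : 'I_dK) (s : R) :
  cell k s -> dyad K k <= s <= dyad K k + (2 ^+ K)^-1.
Proof.
rewrite /cell; case: ifPn => [/eqP kd|_] /=; rewrite in_itv/= => /andP[h1 h2].
  by rewrite h1 -dyadS kd dyad_last.
by rewrite h1 ltW.
Qed.

Lemma cell_measurable (k : 'I_dK) : measurable (cell k : set RM).
Proof. by rewrite /cell; case: ifPn => _; exact: measurable_itv. Qed.

Lemma cell_sub (k : 'I_dK) : cell (R := R) k `<=` I11.
Proof.
move=> s /cellE; rewrite -dyadS I11E => /andP[h1 h2].
have := dyad_I11 (ltnW (ltn_ord k)); have := dyad_I11 (ltn_ord k).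
by rewrite !I11E; lra.
Qed.

Lemma cell_disj (i j : 'I_dK) (s : R) : cell i s -> cell j s -> i = j.
Proof.
wlog ij : i j / (i <= j)%N.
  move=> wl hi hj; have [ij|/ltnW ji] := leqP i j; first exact: wl.
  exact/esym/wl.
move=> hi hj; apply/val_inj/eqP => /=; rewrite eqn_leq ij leqNgt; apply/negP => lt_ij.
have : s < dyad K i.+1.
  move: hi; rewrite /cell ifF; last first.
    by apply/negbTE; rewrite neq_ltn (leq_ltn_trans lt_ij).
  by rewrite /= in_itv/= dyadS => /andP[].
have /andP[+ _] := cellE hj; have : dyad K i.+1 <= dyad K j :> R by exact: dyad_le.
by lra.
Qed.

Lemma cell_cover (s : R) : I11 s -> exists k : 'I_dK, cell k s.
Proof.
rewrite I11E => hs.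
have [s1|s1] := eqVneq s 1.
  have h : (dK.-1 < dK)%N by rewrite prednK ?expn_gt0.
  exists (Ordinal h); rewrite /cell /= prednK ?expn_gt0// eqxx/= in_itv/=.
  rewrite s1 lexx andbT -dyad_last dyad_le//; exact: leq_pred.
have s1' : s < 1 by rewrite lt_neqAle s1; case/andP: hs.
pose n := Num.truncn ((s + 1) * 2 ^+ K).
have p0 : 0 < 2 ^+ K :> R by rewrite exprn_gt0.
have nn : 0 <= (s + 1) * 2 ^+ K by rewrite mulr_ge0 ?(ltW p0)//; lra.
have /andP[n1 n2] := truncn_itv nn.
have nd : (n < dK)%N.
  rewrite -(ltr_nat R) (le_lt_trans n1)// dK_half ltr_pM2r//; lra.
exists (Ordinal nd).
have c1 : dyad K n <= s by rewrite /dyad lerBlDr ler_pdivrMr.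
have c2 : s < dyad K n.+1 by rewrite /dyad ltrBrDr ltr_pdivlMr.
rewrite /cell /=; case: ifPn => _ /=; rewrite in_itv/= c1/=; first by case/andP: hs.
by rewrite -dyadS.
Qed.

Lemma step_cell (h : R -> R) (k : 'I_dK) (s : R) : cell k s -> step h s = h (dyad K k).
Proof.
move=> ks; rewrite /step (bigD1 k)//= indicE mem_set// mulr1 big1 ?addr0// => i ik.
rewrite indicE memNset ?mulr0// => si.
by move/eqP: ik; apply; exact: cell_disj si ks.
Qed.

Lemma indic_bmeas (A : set RM) : measurable A -> bmeas (\1_A : R -> R).
Proof.
move=> mA; split; first exact: measurable_indic.
by exists 1 => s _; rewrite indicE normr_nat lern1 leq_b1.
Qed.

Lemma integ_indic (m : {finite_measure set RM -> \bar R}) (A : set RM) :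
  measurable A -> A `<=` I11 -> integ m (\1_A : R -> R) = fine (m A).
Proof.
by move=> mA AI; rewrite /integ /Rintegral integral_indic// setIidl.
Qed.

Lemma step_bmeas_sum (r : seq 'I_dK) (h : R -> R) :
  bmeas (fun s : R => \sum_(k <- r) h (dyad K k) * \1_(cell k) s).
Proof.
elim: r => [|k r ih]; first by under eq_fun do rewrite big_nil; exact: bmeas_cst.
under eq_fun do rewrite big_cons; apply: bmeasD => //.
by apply: bmeasZ; apply: indic_bmeas; exact: cell_measurable.
Qed.

Lemma integ_step (m : {finite_measure set RM -> \bar R}) (h : R -> R) :
  integ m (step h) = \sum_(k < dK) h (dyad K k) * fine (m (cell k)).
Proof.
rewrite /step; elim: (index_enum _) => [|k r ih].
  rewrite big_nil (eq_integ m (k := cst 0)) ?integ_cst ?mul0r// => s _.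
  by rewrite big_nil.
rewrite big_cons -ih (eq_integ m (k := fun s => h (dyad K k) * \1_(cell k) s +
    \sum_(j <- r) h (dyad K j) * \1_(cell j) s)); last by move=> s _; rewrite big_cons.
have bk : bmeas (\1_(cell (R := R) k) : R -> R) by apply: indic_bmeas; exact: cell_measurable.
rewrite integD; [|exact: bmeasZ|exact: step_bmeas_sum].
by rewrite integZ// integ_indic//; [exact: cell_measurable|exact: cell_sub].
Qed.

Lemma coords_nonneg mu : nonneg (coords K mu).
Proof. by move=> k; rewrite mxE mulr_ge0// fine_ge0. Qed.

(** Transporting mu to the left endpoints of the cells amounts to replacing h
by a step function under the integral. *)
Lemma integ_coords mu h : bmeas h ->
  integ (atomic (coords K mu)) h = integ mu (step h).
Proof.
move=> bh; rewrite integ_atomic//; last exact: coords_nonneg.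
rewrite integ_step mulr_sumr; apply: eq_bigr => k _; rewrite mxE.
by have := dK_gt0 => d0; field; rewrite gt_eqF.
Qed.

Lemma tot_coords mu : tot (atomic (coords K mu)) = tot mu.
Proof.
rewrite -[LHS]mul1r -integ_cst integ_coords; last exact: bmeas_cst.
rewrite -[RHS]mul1r -integ_cst; apply: eq_integ => s /cell_cover[k ks].
by rewrite (step_cell _ ks).
Qed.

Lemma norm1_coords mu : norm1 (coords K mu) = tot mu.
Proof. by rewrite -tot_coords tot_atomic//; exact: coords_nonneg. Qed.

(** Every point is moved by at most the width of a cell. *)
Lemma coords_close mu : close ((2 ^+ K)^-1 * tot mu) (atomic (coords K mu)) mu.
Proof.
move=> h hL hB; have bh := lip_on_bmeas hL; rewrite integ_coords//.
have bs : bmeas (step h) by exact: step_bmeas_sum.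
rewrite -integB//; apply: ler_norm_integ; first exact: bmeasB.
move=> s Is; have [k ks] := cell_cover Is.
rewrite (step_cell _ ks) (le_trans (hL _ _ (dyad_I11 (ltnW (ltn_ord k))) Is))//.
have := cellE ks; rewrite mul1r ler_norml => /andP[h1 h2].
have : 0 <= (2 ^+ K)^-1 :> R by rewrite invr_ge0 exprn_ge0.
lra.
Qed.

End atomic_measures.

(** * Elementary limits *)

(** First-order condition at a maximum: an increment that is linear up to a
quadratic error and has a sign has a slope of that sign. *)
Lemma first_order_le0 (R : realType) (e0 u v : R) : 0 < e0 ->
  (forall e, 0 < e -> e <= e0 -> e * u <= e ^+ 2 * v) -> u <= 0.
Proof.
move=> e00 H; rewrite leNgt; apply/negP => u0.
pose e := Num.min e0 (u / (2 * (`|v| + 1))).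
have v1 : 0 < `|v| + 1 by rewrite ltr_wpDl.
have ep : 0 < e by rewrite lt_min e00 divr_gt0// mulr_gt0.
have ee0 : e <= e0 by rewrite ge_min lexx.
have eu : e * (2 * (`|v| + 1)) <= u.
  by rewrite -ler_pdivlMr ?mulr_gt0// /e ge_min lexx orbT.
have := H e ep ee0; rewrite expr2 -mulrA ler_pM2l// => uv.
have := ler_wpM2l (ltW ep) (ler_norm v); have := mulr_ge0 (ltW ep) (normr_ge0 v); nra.
Qed.

Lemma eps_le0 (R : realType) (x B : R) : 0 <= B -> (forall e, 0 < e -> x <= B * e) -> x <= 0.
Proof.
move=> B0 H; apply/ler_addgt0Pr => e e0; rewrite add0r.
have B1 : 0 < B + 1 by rewrite ltr_wpDl.
rewrite (le_trans (H (e / (B + 1)) _)) ?divr_gt0//.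
rewrite mulrCA ler_piMr ?(ltW e0)// ler_pdivrMr// mul1r; lra.
Qed.

Lemma pow2_small (R : realType) (e : R) : 0 < e -> \forall K \near \oo, (2 ^+ K)^-1 <= e.
Proof.
move=> e0; exists (Num.truncn e^-1) => // K /= hK.
rewrite invf_ple ?posrE ?exprn_gt0//.
rewrite (le_trans (ltW (truncnS_gt _)))// -natrX ler_nat.
by rewrite (leq_trans _ (ltn_expl K _))// ltnS.
Qed.

(** * The Hamiltonian on a dyadic level *)

Section hamiltonian.
Context {R : realType} (K : nat).
Local Notation dK := (2 ^ K.+1)%N.
Local Notation V := 'cV[R]_dK.
Variables (q : R -> R) (C m : R).
Hypotheses (qC : kernel_bound C q) (m0 : 0 < m).
Hypothesis qm : forall s, I11 s -> m <= q s.
Local Notation Q := (kmatrix K q).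
Hypothesis Q_psd : forall x : V, 0 <= dot x (Q *m x).
Implicit Types (x y z w : V).

Let d0 : 0 < dK%:R :> R. Proof. exact: dK_gt0. Qed.

Let dyadM_I11 (i j : 'I_dK) : I11 (dyad K i * dyad K j : R).
Proof. by apply: I11M; apply: dyad_I11; exact: ltnW. Qed.

Lemma kmatrix_sym x y : dot x (Q *m y) = dot y (Q *m x).
Proof.
rewrite /dot; under eq_bigr do rewrite mxE mulr_sumr.
rewrite exchange_big/=; apply: eq_bigr => i _; rewrite mxE mulr_sumr.
by apply: eq_bigr => j _; rewrite !mxE [dyad K j * _]mulrC; ring.
Qed.

Lemma kmatrix_ge z k : nonneg z -> dK%:R^-1 * m * norm1 z <= (Q *m z) k 0.
Proof.
move=> z0; rewrite norm1_nneg// mxE !mulr_sumr; apply: ler_sum => j _.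
rewrite mulrA ler_wpM2r// mxE expr2 invfM mulrA.
by rewrite ler_wpM2r ?invr_ge0// mulrC ler_wpM2r ?invr_ge0// qm.
Qed.

Lemma kmatrix_norm z : nonneg z -> norm1s (Q *m z) <= C * norm1 z.
Proof.
have [C0 _ qB] := qC.
move=> z0; apply: norm1s_le; first by rewrite mulr_ge0// norm1_ge0.
move=> k; rewrite -ler_pdivlMl// mxE (le_trans (ler_norm_sum _ _ _))//.
rewrite norm1_nneg// !mulr_sumr; apply: ler_sum => j _.
rewrite normrM (ger0_norm (z0 j)) !mulrA ler_wpM2r// mxE normrM expr2 invfM.
rewrite (@ger0_norm _ (_ / _)) ?divr_ge0// mulrA ler_wpM2r ?invr_ge0// mulrC.
by rewrite ler_wpM2l ?invr_ge0// qB.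
Qed.

Lemma quad_ge z : nonneg z -> m * norm1 z ^+ 2 <= dot z (Q *m z).
Proof.
move=> z0.
have -> : m * norm1 z ^+ 2 = \sum_k z k 0 * (dK%:R^-1 * m * norm1 z).
  by rewrite -mulr_suml expr2 mulrA {1}norm1_nneg//; ring.
by apply: ler_sum => k _; rewrite ler_wpM2l// kmatrix_ge.
Qed.

Definition En z : R := dot z (Q *m z) / 2.

Lemma En_ge0 z : 0 <= En z. Proof. by rewrite divr_ge0. Qed.

(** The symmetry of kmatrix merges the two cross terms. *)
Lemma EnD z w c : En (z + c *: w) =
  En z + c * dot w (Q *m z) + c ^+ 2 * En w.
Proof.
rewrite /En mulmxDr -scalemxAr !(dotDl, dotDr, dotZl, dotZr) (kmatrix_sym z w).
by field.
Qed.

Lemma En_cont : continuous En.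
Proof.
move=> x; apply: (@continuousM R V (fun z => dot z (Q *m z)) (cst 2^-1)); last exact: cst_continuous.
apply: dot_continuous => k {}x; first exact: coord_continuous.
under eq_fun do rewrite mxE; apply: continuous_sumr => j {}x.
by apply: continuousM; [exact: cst_continuous|exact: coord_continuous].
Qed.

Lemma En_convex z w s : 0 <= s -> s <= 1 ->
  En (s *: z + (1 - s) *: w) <= s * En z + (1 - s) * En w.
Proof.
move=> s0 s1; rewrite -subr_ge0.
rewrite (_ : s *: z + (1 - s) *: w = w + s *: (z - w)); last first.
  by apply/matrixP => i j; rewrite !mxE; ring.
have zE : z = w + 1 *: (z - w) by rewrite scale1r addrC subrK.
rewrite EnD [in En z]zE EnD expr1n.
have -> : s * (En w + 1 * dot (z - w) (Q *m w) + 1 * En (z - w)) + (1 - s) * En w -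
   (En w + s * dot (z - w) (Q *m w) + s ^+ 2 * En (z - w)) = s * (1 - s) * En (z - w) by ring.
by rewrite mulr_ge0 ?En_ge0// mulr_ge0// subr_ge0.
Qed.

(** This is En (x - z) >= 0. *)
Lemma fenchel_young z x : dot z (Q *m x) - En z <= En x.
Proof.
have := En_ge0 (x + (-1) *: z); rewrite EnD sqrrN expr1n; lra.
Qed.

(** A large multiple of the constant vector dominates y, since q >= m > 0; so
the infimum in Hfun is over a nonempty set. *)
Lemma cone_dominates y : exists2 x, nonneg x & forall k, y k 0 <= (Q *m x) k 0.
Proof.
(* The entries of Q applied to the constant c are at least m c / dK. *)
pose c := norm1s y / m; have c0 : 0 <= c by rewrite divr_ge0 ?norm1s_ge0// ltW.
have x0 : nonneg (const_mx c : V) by move=> k; rewrite mxE.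
exists (const_mx c) => // k; rewrite (le_trans _ (kmatrix_ge k x0))//.
have -> : norm1 (const_mx c : V) = c.
  rewrite norm1_nneg//; under eq_bigr do rewrite mxE.
  by rewrite sumr_const card_ord -(mulr_natl c) mulKf// gt_eqF.
rewrite (le_trans (ler_norm _))//.
have -> : dK%:R^-1 * m * c = dK%:R^-1 * norm1s y by rewrite /c -mulrA [m * _]mulrC divfK// gt_eqF.
by rewrite ler_pdivlMl// coord_le_norm1s.
Qed.

Variables (L M r : R).
Hypotheses (L0 : 0 <= L) (LM : L < m * M) (Mr : m * M <= 4 * r) (CMr : C * M <= r).

Let M0 : 0 < M.
Proof. by rewrite -(pmulr_rgt0 _ m0) (le_lt_trans L0). Qed.

Let r_ge0 : 0 <= r.
Proof. by have [C0 _ _] := qC; rewrite (le_trans _ CMr)// mulr_ge0// ltW. Qed.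

(** Whatever preimage x1 of w is selected in Cfun, this is the Fenchel-Young
inequality for x1. *)
Lemma Cfun_ge z w : cone q w -> dot z w - En z <= Cfun q w.
Proof.
move=> [x x0 wx]; rewrite /Cfun.
set P := (X in xget _ X).
have [_] : P (xget 0 P) by apply: (@xgetPex _ 0 P); exists x.
move: (xget 0 P) => x1 wE.
by have := fenchel_young z x1; rewrite {2}/En -wE [dot x1 w]dotC.
Qed.

(** By symmetry of kmatrix, the selected preimage of Q z gives the same value
as z. *)
Lemma Cfun_kmatrix z : nonneg z -> Cfun q (Q *m z) = En z.
Proof.
move=> z0; rewrite /Cfun; set P := (X in xget _ X).
have [_] : P (xget 0 P) by apply: (@xgetPex _ 0 P); exists z.
move: (xget 0 P) => x1 wE.
by rewrite dotC kmatrix_sym -/(En z) /En -wE.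
Qed.

(** Inside the ball of radius 2 r this is Cfun_ge.  Outside, the linear branch of
Ctilde exceeds 4 r / m times the norm of w, hence dot z w as m M <= 4 r. *)
Lemma Ctilde_ge z w : ball_pos M z -> cone q w -> dot z w - En z <= Ctilde q m r w.
Proof.
move=> [z0 zM] wc; rewrite /Ctilde; case: ifPn => [_|].
  by rewrite le_max Cfun_ge.
rewrite -ltNge => rw; rewrite (@le_trans _ _ (dot z w))//.
  by rewrite gerBl En_ge0.
rewrite (le_trans (ler_norm _))// (le_trans (dot_le _ _))//.
rewrite (le_trans (ler_wpM2r (norm1s_ge0 _) zM))//.
rewrite -(ler_pM2l m0) mulrA (le_trans (ler_wpM2r (norm1s_ge0 _) Mr))//.
have -> : m * (8 * r / m * (norm1s w - r)) = 8 * r * (norm1s w - r).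
  by field; rewrite gt_eqF.
have : 0 <= r * (norm1s w - 2 * r) by rewrite mulr_ge0// subr_ge0 ltW.
by lra.
Qed.

(** A nonnegative z pairs monotonically with the vectors w >= y. *)
Lemma Hfun_ge y z : ball_pos M z -> dot z y - En z <= Hfun q m r y.
Proof.
move=> Mz; apply: lb_le_inf.
  have [x x0 xy] := cone_dominates y.
  by exists (Ctilde q m r (Q *m x)); exists (Q *m x) => //; split => //; exists x.
move=> _ [w [wc yw] <-]; rewrite (le_trans _ (Ctilde_ge Mz wc))// lerD2r.
by apply: ler_sum => k _; rewrite ler_wpM2l//; case: Mz.
Qed.

(** These are the complementarity conditions for z.  Varying z along itself and
along the coordinate vectors is allowed once the mass constraint is known to be
inactive; scaling z down gives dot z (Q z) <= dot z y <= L norm1 z, and since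
the left-hand side is at least m (norm1 z)^2, the mass is at most L / m < M. *)
Lemma quad_max y : norm1s y <= L -> exists z, [/\ ball_pos M z,
  dot z (Q *m z) = dot z y & forall k, y k 0 <= (Q *m z) k 0].
Proof.
move=> yL; pose f z := dot z y - En z.
have cf : continuous f.
  move=> x; apply: (@continuousB R R V (fun z => dot z y) En); last exact: En_cont.
  by apply: dot_continuous => k {}x; [exact: coord_continuous|exact: cst_continuous].
have [z /set_mem Mz zmax] := compact_EVT_max
  (ex_intro _ _ (ball_pos0 (d := dK) (ltW M0))) (@ball_pos_compact R dK M) (continuous_subspaceT cf).
have {}zmax w : ball_pos M w -> f w <= f z by move=> /mem_set; exact: zmax.
have [z0 zM] := Mz; pose A := dot z y; pose B := dot z (Q *m z).
have BA : B <= A.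
  rewrite -subr_le0; apply: (@first_order_le0 _ 1 _ (B / 2)) => // e e0 e1.
  have Mw : ball_pos M (z + (- e) *: z).
    rewrite -[X in X + _]scale1r -scalerDl; split; first by apply: nonnegZ; rewrite // subr_ge0.
    rewrite norm1Z ger0_norm ?subr_ge0// (le_trans _ zM)// ler_piMl ?norm1_ge0//.
    by rewrite gerBl ltW.
  have := zmax _ Mw; rewrite /f dotDl dotZl EnD /En -/A -/B; lra.
have zlt : norm1 z < M.
  have [->//|n0] := eqVneq (norm1 z) 0.
  have n_gt0 : 0 < norm1 z by rewrite lt_neqAle norm1_ge0 eq_sym n0.
  have := le_trans (quad_ge z0) (le_trans BA (le_trans (ler_norm _) (dot_le _ _))).
  rewrite expr2 mulrA mulrC ler_pM2l// => h.
  by rewrite -(ltr_pM2l m0) (le_lt_trans h)// (le_lt_trans yL).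
have AB : A <= B.
  rewrite -subr_le0; apply: (@first_order_le0 _ (M / (norm1 z + 1) - norm1 z / (norm1 z + 1)) _ (B / 2)).
    by rewrite -mulrBl divr_gt0 ?subr_gt0// ltr_wpDl// norm1_ge0.
  move=> e e0; rewrite -mulrBl ler_pdivlMr ?ltr_wpDl ?norm1_ge0// => e1.
  have Mw : ball_pos M (z + e *: z).
    rewrite -[X in X + _]scale1r -scalerDl; split; first by apply: nonnegZ; rewrite // addr_ge0// ltW.
    rewrite norm1Z gtr0_norm ?addr_gt0//; lra.
  have := zmax _ Mw; rewrite /f dotDl dotZl EnD /En -/A -/B; lra.
exists z; split=> //; first by apply/le_anti; rewrite -/A -/B AB BA.
move=> k; rewrite -subr_le0; apply: (@first_order_le0 _ (dK%:R * (M - norm1 z)) _ (En (delta_mx k 0))).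
  by rewrite mulr_gt0// subr_gt0.
move=> e e0 e1.
have Mw : ball_pos M (z + e *: delta_mx k 0).
  split; first by apply: nonnegD => //; apply: nonnegZ; [exact: ltW|exact: nonneg_delta].
  rewrite (le_trans (norm1D _ _))// norm1_delta gtr0_norm//.
  by rewrite -lerBrDl ler_pdivrMl.
have := zmax _ Mw; rewrite /f dotDl dotZl EnD !dot_delta; lra.
Qed.

(** The vector Q z of quad_max is a competitor in the infimum; as its norm is at
most C M <= r, the truncation in Ctilde is not active there. *)
Lemma Hfun_le y : norm1s y <= L ->
  exists2 z, ball_pos M z & Hfun q m r y <= dot z y - En z.
Proof.
move=> yL; have [z [Mz zE yz]] := quad_max yL; exists z => //.
have [z0 zM] := Mz.
have -> : dot z y - En z = Ctilde q m r (Q *m z).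
  have nz : norm1s (Q *m z) <= r.
    have [C0 _ _] := qC.
    by rewrite (le_trans (kmatrix_norm z0))// (le_trans _ CMr)// ler_wpM2l.
  rewrite /Ctilde ifT; last by rewrite (le_trans nz)// ler_peMl// ler1n.
  rewrite Cfun_kmatrix// (max_idPl _); first by rewrite /En zE; field.
  rewrite (le_trans _ (En_ge0 z))// mulr_ge0_le0//.
    by rewrite divr_ge0// ?mulr_ge0// ltW.
  by rewrite subr_le0.
apply: ge_inf; last by exists (Q *m z) => //; split => //; exists z.
exists (dot (0 : V) y - En 0) => _ [w [wc yw] <-].
rewrite (le_trans _ (Ctilde_ge (ball_pos0 (ltW M0)) wc))// lerD2r.
by apply: ler_sum => k _; rewrite !mxE !mul0r.
Qed.

End hamiltonian.

(** * Weak compactness *)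

Section ultralimits.
Context {R : realType} (U : set_system nat) (UU : UltraFilter U).

(** A bounded sequence has a cluster point along the ultrafilter, and a cluster
point of an ultrafilter is a limit. *)
Lemma ultra_bounded_cvg (a : nat -> R) (b c : R) : (forall n, b <= a n <= c) ->
  exists2 l, b <= l <= c & a n @[n --> U] --> l.
Proof.
move=> abc; have PU : ProperFilter U by exact: ultra_proper.
have aU : (a @ U) `[b, c]%classic.
  by apply: (@filterS _ U _ setT); [move=> n _; rewrite /= in_itv/=; exact: abc|exact: filterT].
have [l [+ cl]] := @segment_compact R b c (a @ U) _ aU; rewrite /= in_itv/= => lbc; exists l => //.
move=> B Bl; have [//|UnB] := in_ultra_setVsetC (a @^-1` B) UU.
have [y [/= nBy By]] := cl (~` B) B UnB Bl.
by case: nBy.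
Qed.

End ultralimits.

Section weak_compactness.
Context {R : realType}.
Local Notation RM := (measurableTypeR R).
Implicit Types (X : R -> R) (h : R -> R).

Let half : {nonneg R} := NngNum (ltW (@divr_gt0 R 1 2 ltr01 (ltr0n R 2))).

Definition uniform_measure : {measure set RM -> \bar R} :=
  mscale half (mrestr (@lebesgue_measure R) (@measurable_I11 R)).

Lemma uniform_measureE (A : set RM) :
  uniform_measure A = ((1 / 2)%:E * lebesgue_measure (A `&` I11))%E.
Proof. by []. Qed.

Lemma lebesgue_cc (a b : R) : a <= b -> lebesgue_measure `[a, b]%classic = (b - a)%:E.
Proof.
move=> ab; rewrite lebesgue_measure_itv/= lte_fin -EFinB; case: ltP => // ba.
by rewrite (_ : b = a) ?subrr//; apply/le_anti; rewrite ab ba.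
Qed.

Let uniform_fin : fin_num_fun uniform_measure.
Proof.
move=> A mA; rewrite uniform_measureE fin_numM// ge0_fin_numE//.
rewrite (@le_lt_trans _ _ (lebesgue_measure (I11 : set R)))//.
  have mAI := measurableI _ _ mA (@measurable_I11 R).
  by apply: le_measure; [exact: (mem_set mAI)|exact: (mem_set (@measurable_I11 R))|exact: subIsetr].
have -> : lebesgue_measure (I11 : set R) = (1 - -1)%:E by apply: lebesgue_cc; lra.
exact: ltry.
Qed.

Let uniform_supp : pack_fin_measure uniform_fin (~` I11) = 0%E.
Proof. by rewrite [LHS]uniform_measureE setICl measure0 mule0. Qed.

Definition unif : Mplus R := MkMplus uniform_supp.

Lemma unif_cc (a b : R) : -1 <= a -> a <= b -> b <= 1 ->
  fine (unif `[a, b]%classic) = (b - a) / 2.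
Proof.
move=> a1 ab b1; rewrite [unif _]uniform_measureE setIidl ?lebesgue_cc//=.
  by rewrite mul1r mulrC.
by move=> s; rewrite I11E /= in_itv/=; lra.
Qed.

Lemma tot_unif : tot unif = 1.
Proof. by rewrite /tot unif_cc//; lra. Qed.

Lemma unif_cell K (k : 'I_(2 ^ K.+1)) : fine (unif (cell k)) = (2 * 2 ^+ K)^-1.
Proof.
have c0 : 0 <= (2 ^+ K)^-1 :> R by rewrite invr_ge0 exprn_ge0.
have cc : fine (unif `[dyad K k, dyad K k.+1]%classic) = (2 * 2 ^+ K)^-1.
  have h1 := dyad_I11 (R := R) (ltnW (ltn_ord k)); have h2 := dyad_I11 (R := R) (ltn_ord k).
  move: h1 h2; rewrite !I11E => /andP[h1 h2] /andP[h3 h4].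
  rewrite unif_cc//; last exact: dyad_le.
  by rewrite dyadS invfM; lra.
rewrite -cc /cell; case: ifPn => [/eqP kd|_].
  by rewrite [in RHS]kd dyad_last.
rewrite -dyadS !uniform_measureE.
have sub (s : R) : dyad K k <= s <= dyad K k.+1 -> I11 s.
  have := dyad_I11 (R := R) (ltnW (ltn_ord k)); have := dyad_I11 (R := R) (ltn_ord k).
  by rewrite !I11E => /andP[? ?] /andP[? ?] /andP[? ?]; apply/andP; split; lra.
have h1 : `[dyad K k, dyad K k.+1[%classic `&` I11 = `[dyad K k, dyad K k.+1[%classic :> set R.
  by apply: setIidl => s; rewrite /= in_itv/= => /andP[s1 /ltW s2]; apply: sub; rewrite s1.
have h2 : `[dyad K k, dyad K k.+1]%classic `&` I11 = `[dyad K k, dyad K k.+1]%classic :> set R.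
  by apply: setIidl => s; rewrite /= in_itv/= => hs; apply: sub.
by rewrite h1 h2 !lebesgue_measure_itv.
Qed.

Lemma bmeas_comp X h : nondecreasing_fun X -> (forall u, I11 (X u)) -> bmeas h ->
  bmeas (h \o X).
Proof.
move=> Xm XI [mh [M hM]]; split; last by exists M => x _; exact: hM.
apply: (@measurable_comp _ _ _ RM RM RM (I11 : set RM)) => //.
  by move=> _ [u _ <-]; exact: XI.
by apply: nondecreasing_measurable => //; exact: measurable_I11.
Qed.

Lemma mono_bmeas X : nondecreasing_fun X -> (forall u, I11 (X u)) -> bmeas X.
Proof.
move=> Xm XI; apply: (bmeas_comp Xm XI (h := id)).
by apply: (lip_on_bmeas (L := 1)) => x y _ _; rewrite mul1r.
Qed.

(** The law of X under the uniform distribution on [-1, 1]. *)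
Lemma law_exists X : nondecreasing_fun X -> (forall u, I11 (X u)) ->
  exists nu : Mplus R, forall h, bmeas h -> integ nu h = integ unif (h \o X).
Proof.
move=> Xm XI; have mX : measurable_fun [set: RM] (X : RM -> RM).
  exact: nondecreasing_measurable.
pose P0 : {measure set RM -> \bar R} := pushforward unif (X : RM -> RM).
pose P := P0 mX.
have PE A : P A = unif (X @^-1` A) by [].
have fP : fin_num_fun P.
  move=> A mA; rewrite PE fin_num_measure//.
  by rewrite -[X in measurable X]setTI; exact: (mX measurableT A mA).
have sP : pack_fin_measure fP (~` I11) = 0%E.
  rewrite [LHS]PE (_ : _ @^-1` _ = set0) ?measure0//.
  by apply/seteqP; split => // u /=; have := XI u.
pose nu := MkMplus sP; exists nu.
have pos h : bmeas h -> (forall s, I11 s -> 0 <= h s) -> integ nu h = integ unif (h \o X).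
  move=> bh h0.
  have bhX := bmeas_comp Xm XI bh.
  rewrite /integ /Rintegral; congr fine.
  transitivity (\int[P]_(x in I11) (h x)%:E)%E; first by apply: eq_measure_integral.
  have hE : measurable_fun (I11 : set RM) (EFin \o h) by apply/measurable_EFinP; case: bh.
  rewrite (ge0_integral_pushforward mX unif (measurable_I11 : measurable (I11 : set RM)) hE); last first.
    by move=> y /set_mem Iy; rewrite lee_fin h0.
  have -> : X @^-1` I11 = setT by apply/seteqP; split => // u _; exact: XI.
  have mIC : measurable (~` (I11 : set RM)) by apply: measurableC; exact: measurable_I11.
  have mhX : measurable_fun [set: RM] (h \o X).
    case: bh => mh _; apply: (@measurable_comp _ _ _ RM RM RM (I11 : set RM)) => //.
    by move=> _ [u _ <-]; exact: XI.
  rewrite (ge0_negligible_integral mIC)//; last first.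
  - by move=> u _ /=; rewrite lee_fin h0.
  - exact/measurable_EFinP.
  by rewrite setTD setCK.
move=> h bh; have [_ [M hM]] := bh.
have bM := bmeas_cst M.
have bhX := bmeas_comp Xm XI bh.
have tnu : tot nu = 1.
  rewrite -[LHS]mul1r -integ_cst pos; [|exact: bmeas_cst|by []].
  by rewrite -[RHS](tot_unif) -[RHS]mul1r -integ_cst.
have -> : integ nu h = integ nu (fun s => h s + cst M s) - M * tot nu.
  by rewrite integD// integ_cst addrK.
rewrite pos; first last.
- by move=> y /hM; rewrite ler_norml /= => /andP[? _]; lra.
- exact: bmeasD.
have -> : integ unif ((fun s => h s + cst M s) \o X) = integ unif (fun s => (h \o X) s + cst M s) by [].
by rewrite integD// integ_cst tnu tot_unif addrK.
Qed.

Section quantile.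
Variables (K : nat) (p : nat -> R).
Hypothesis p0 : forall k, 0 <= p k.
Let cum n : R := \sum_(k < n) p k.

(** The quantile function of the measure with weights p k at dyad K k, for k < n,
and the remaining mass at dyad K n.  The variable u runs through [-1, 1] instead
of [0, 1], whence the thresholds 2 c - 1 for cumulated weights c. *)
Fixpoint quantile n (u : R) : R :=
  if n is n'.+1 then
    if 2 * \sum_(k < n'.+1) p k - 1 <= u then dyad K n'.+1 else quantile n' u
  else dyad K 0.

Lemma quantile_top n u : 2 * cum n - 1 <= u -> quantile n u = dyad K n.
Proof. by case: n => //= n ->. Qed.

Lemma quantile_le n u : dyad K 0 <= quantile n u <= dyad K n.
Proof.
elim: n => [|n ih] /=; first by rewrite lexx.
case: ifPn => _; first by rewrite lexx dyad_le.
case/andP: ih => -> /= h; rewrite (le_trans h)// dyad_le//.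
Qed.

Lemma quantile_mono n : nondecreasing_fun (quantile n).
Proof.
elim: n => [|n ih] u v uv //=; case: ifPn => hu.
  by rewrite (le_trans hu uv).
case: ifPn => _; last exact: ih.
by have /andP[_ h] := quantile_le n u; rewrite (le_trans h)// dyad_le.
Qed.

Lemma quantile_I11 n u : (n <= 2 ^ K.+1)%N -> I11 (quantile n u).
Proof.
move=> nd; have := dyad_I11 (R := R) nd; have := quantile_le n u.
by rewrite dyad_first !I11E => /andP[-> h] /andP[_ h']; rewrite (le_trans h).
Qed.

(** Adding an atom changes h o quantile only above the last threshold, by a
constant; so the formula follows by induction. *)
Lemma quantile_integ n h : (n <= 2 ^ K.+1)%N -> cum n <= 1 -> bmeas h ->
  integ unif (h \o quantile n) =
    \sum_(k < n) p k * h (dyad K k) + (1 - cum n) * h (dyad K n).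
Proof.
move=> + + bh; elim: n => [|n ih] nd c1.
  rewrite /cum !big_ord0 add0r subr0 mul1r.
  rewrite (_ : h \o quantile 0 = cst (h (dyad K 0)))// integ_cst tot_unif mulr1//.
have cS : cum n.+1 = cum n + p n by rewrite /cum big_ord_recr.
have c0 : 0 <= cum n.+1 by apply: sumr_ge0.
pose A : set R := `[2 * cum n.+1 - 1, 1]%classic.
have mA : measurable (A : set RM) by exact: measurable_itv.
have AI : A `<=` I11 by move=> s; rewrite /A I11E /= in_itv/=; lra.
rewrite (eq_integ unif (k := fun u => (h \o quantile n) u +
    (h (dyad K n.+1) - h (dyad K n)) * \1_A u)); last first.
  move=> u; rewrite I11E => /andP[u0 u1] /=; rewrite -/(cum n.+1) indicE.
  case: ifPn => hu.
    rewrite mem_set ?mulr1; last by rewrite /A /= in_itv/= hu u1.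
    rewrite quantile_top; first by rewrite addrC subrK.
    by rewrite (le_trans _ hu)// cS; have := p0 n; lra.
  rewrite memNset ?mulr0 ?addr0// /A /= in_itv/= => /andP[hu' _].
  by rewrite hu' in hu.
have bq : bmeas (h \o quantile n).
  apply: bmeas_comp => //; first exact: quantile_mono.
  by move=> u; apply: quantile_I11; exact: ltnW.
have bA : bmeas (\1_A : R -> R) by exact: indic_bmeas.
rewrite integD//; last exact: bmeasZ.
rewrite integZ// integ_indic// ih ?(ltnW nd)//; last first.
  by rewrite (le_trans _ c1)// cS lerDl.
rewrite unif_cc//; [|lra|lra].
by rewrite big_ord_recr/= cS; field.
Qed.

End quantile.

(** The weights are normalized by the mass of z.  All coordinates are consumed, so
that no mass is left at the endpoint dyad K (2 ^ K.+1) = 1. *)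
Lemma atomic_quantile K (z : 'cV[R]_(2 ^ K.+1)) : nonneg z ->
  exists X, [/\ nondecreasing_fun X, forall u, I11 (X u) &
    forall h, bmeas h -> integ (atomic z) h = norm1 z * integ unif (h \o X)].
Proof.
move=> z0; have [n0|n0] := eqVneq (norm1 z) 0.
  exists (cst 0); split => //.
    by move=> u; rewrite I11E /=; lra.
  move=> h bh; rewrite n0 mul0r; have [_ [M hM]] := bh.
  apply/eqP; rewrite -normr_le0 (le_trans (ler_norm_integ _ bh hM))//.
  by rewrite tot_atomic// n0 mulr0.
have n_gt0 : 0 < norm1 z by rewrite lt_neqAle norm1_ge0 eq_sym n0.
pose p (k : nat) : R := if insub k is Some i then z i 0 / (2 ^ K.+1)%:R / norm1 z else 0.
have p_ge0 k : 0 <= p k by rewrite /p; case: insubP => // i _ _; rewrite !divr_ge0// norm1_ge0.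
have pE (k : 'I_(2 ^ K.+1)) : p k = z k 0 / (2 ^ K.+1)%:R / norm1 z by rewrite /p valK.
have p1 : \sum_(k < 2 ^ K.+1) p k = 1.
  under eq_bigr do rewrite pE.
  by rewrite -!mulr_suml [_ / _%:R]mulrC -norm1_nneg// divff.
exists (quantile K p (2 ^ K.+1)); split.
- exact: quantile_mono.
- by move=> u; exact: quantile_I11.
move=> h bh; rewrite quantile_integ ?p1// subrr mul0r addr0 integ_atomic//.
rewrite !mulr_sumr; apply: eq_bigr => k _; rewrite pE.
by have := dK_gt0 (R := R) K => d0; field; rewrite n0 gt_eqF.
Qed.

(** On a cell, both functions lie between their values at the endpoints, so they
differ by at most e plus the increment of X over the cell.  These increments add
up to at most 2, and each cell has mass 1 / (2 * 2^N). *)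
Lemma monotone_L1_close N X Y (e : R) : nondecreasing_fun X -> nondecreasing_fun Y ->
  (forall u, I11 (X u)) -> (forall u, I11 (Y u)) ->
  (forall k, (k <= 2 ^ N.+1)%N -> `|Y (dyad N k) - X (dyad N k)| <= e) ->
  integ unif (fun u => `|Y u - X u|) <= (2 ^+ N)^-1 + e.
Proof.
move=> Xm Ym XI YI XY.
have c0 : 0 < 2 ^+ N :> R by rewrite exprn_gt0.
pose D s := X (s + (2 ^+ N)^-1) - X s.
have bX := mono_bmeas Xm XI; have bY := mono_bmeas Ym YI.
have bXY : bmeas (fun u => `|Y u - X u|).
  have [m [M hM]] := bmeasB bY bX; split; first exact: measurableT_comp.
  by exists M => x /hM; rewrite normr_id.
have bD : bmeas (step N D) by exact: step_bmeas_sum.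
have be := bmeas_cst e.
rewrite (@le_trans _ _ (integ unif (fun u => step N D u + cst e u)))//.
  apply: ler_integ => //; first exact: bmeasD.
  move=> u /(cell_cover N)[k ku]; rewrite (step_cell _ ku) /D -dyadS /cst.
  have := cellE ku; rewrite -dyadS => /andP[u1 u2].
  have := XY k (ltnW (ltn_ord k)); have := XY k.+1 (ltn_ord k).
  have := Xm _ _ u1; have := Xm _ _ u2; have := Ym _ _ u1; have := Ym _ _ u2.
  by rewrite !ler_norml => ? ? ? ? /andP[? ?] /andP[? ?]; apply/andP; split; lra.
rewrite integD// integ_cst tot_unif mulr1 lerD2r integ_step.
under eq_bigr do rewrite unif_cell.
rewrite -mulr_suml invfM mulrA ler_piMl ?invr_ge0 ?(ltW c0)//.
have -> : \sum_(k < 2 ^ N.+1) D (dyad N k) = X (dyad N (2 ^ N.+1)) - X (dyad N 0).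
  under eq_bigr do rewrite /D -dyadS.
  by rewrite -(big_mkord predT (fun k => X (dyad N k.+1) - X (dyad N k))) telescope_sumr.
have := XI (dyad N (2 ^ N.+1)); have := XI (dyad N 0).
rewrite !I11E => /andP[? ?] /andP[? ?]; lra.
Qed.

(** Helly selection in terms of quantile functions: the masses and the values of
the quantile functions at every point converge along an ultrafilter.  The
limits define a mass and a monotone function, and monotone_L1_close turns
convergence at finitely many points into convergence in mean. *)
Lemma weak_compact M (z : forall K, 'cV[R]_(2 ^ K.+1)) : (forall K, ball_pos M (z K)) ->
  exists U : set_system nat, [/\ ProperFilter U, \oo `<=` U &
    exists nu : Mplus R, forall e, 0 < e ->
      \forall K \near U, close e (atomic (z K)) nu].
Proof.
move=> zM; have [U [UU oU]] := ultraFilterLemma (F := \oo) _.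
have PU : ProperFilter U by exact: ultra_proper.
exists U; split=> //.
have /choice[X XP] K : exists X, [/\ nondecreasing_fun X, forall u, I11 (X u) &
    forall h, bmeas h -> integ (atomic (z K)) h = norm1 (z K) * integ unif (h \o X)].
  by apply: atomic_quantile; case: (zM K).
have [s /andP[s0 sM] cs] : exists2 s, 0 <= s <= M & norm1 (z K) @[K --> U] --> s.
  by apply: ultra_bounded_cvg => K; rewrite norm1_ge0; case: (zM K).
have /choice[Y YP] u : exists l : R, -1 <= l <= 1 /\ X K u @[K --> U] --> l.
  have [l lI cl] : exists2 l : R, -1 <= l <= 1 & X K u @[K --> U] --> l.
    by apply: ultra_bounded_cvg => K; have [_ XI _] := XP K; rewrite -I11E.
  by exists l.
have Ym : nondecreasing_fun Y.
  move=> u v uv; apply: (ler_cvg_to (YP u).2 (YP v).2).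
  by apply: nearW => K; have [Xm _ _] := XP K; exact: Xm.
have YI u : I11 (Y u) by rewrite I11E; exact: (YP u).1.
have [nu0 nu0E] := law_exists Ym YI.
exists (comb s 0 nu0 nu0) => e e0.
have M0 : 0 <= M by rewrite (le_trans s0).
pose c := e / (4 * (M + 1)); have c0 : 0 < c by rewrite divr_gt0// mulr_gt0// ltr_wpDl.
have [N hN] : exists N, (2 ^+ N)^-1 <= c.
  exists (Num.truncn c^-1); rewrite invf_ple ?posrE ?exprn_gt0//.
  rewrite (le_trans (ltW (truncnS_gt _)))// -natrX ler_nat; exact: ltn_expl.
have near_pts : \forall K \near U, forall k : 'I_(2 ^ N.+1).+1,
    `|Y (dyad N k) - X K (dyad N k)| <= c.
  by apply: filter_forall => k; exact: cvgr_dist_le (YP _).2 _ c0.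
have near_s : \forall K \near U, `|s - norm1 (z K)| <= e / 2.
  by apply: cvgr_dist_le cs _ _; rewrite divr_gt0.
apply: filterS2 near_pts near_s => K pts sK h hL hB.
have [Xm XI XE] := XP K.
have bh := lip_on_bmeas hL.
rewrite XE// integ_comb// (max_idPl s0) maxxx mul0r addr0 nu0E//.
have bhX := bmeas_comp Xm XI bh; have bhY := bmeas_comp Ym YI bh.
have bX := mono_bmeas Xm XI; have bY := mono_bmeas Ym YI.
have bXY : bmeas (fun u => `|X K u - Y u|).
  have [m [B hBd]] := bmeasB bX bY; split; first exact: measurableT_comp.
  by exists B => x /hBd; rewrite normr_id.
have h1 : `|integ unif (h \o X K)| <= 1.
  rewrite -[leRHS]mul1r -[X in 1 * X]tot_unif; apply: ler_norm_integ => // u _.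
  exact: hB.
have h2 : `|integ unif (h \o X K) - integ unif (h \o Y)| <= (2 ^+ N)^-1 + c.
  rewrite (@le_trans _ _ (integ unif (fun u => `|X K u - Y u|)))//; last first.
    apply: monotone_L1_close => // k kN.
    by rewrite distrC; exact: (pts (Ordinal (kN : (k < (2 ^ N.+1).+1)%N))).
  have diff v w : I11 v -> I11 w -> h v - h w <= `|v - w|.
    by move=> hv hw; have := hL v w hv hw; rewrite mul1r; apply: le_trans (ler_norm _).
  rewrite ler_norml -integB// -mulN1r -integZ//; apply/andP; split.
    apply: ler_integ; [exact: bmeasZ|exact: bmeasB|move=> u _].
    by rewrite mulN1r lerNl opprB distrC; apply: diff; [exact: YI|exact: XI].
  by apply: ler_integ; [exact: bmeasB|by []|move=> u _; apply: diff].
have -> : norm1 (z K) * integ unif (h \o X K) - s * integ unif (h \o Y) =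
    - (s - norm1 (z K)) * integ unif (h \o X K)
    + s * (integ unif (h \o X K) - integ unif (h \o Y)) by ring.
rewrite (le_trans (ler_normD _ _))// !normrM normrN (ger0_norm s0).
have h3 := ler_pM (normr_ge0 _) (normr_ge0 _) sK h1.
have h4 := ler_pM s0 (normr_ge0 _) sM h2.
have : M * ((2 ^+ N)^-1 + c) <= M * (c + c) by rewrite ler_wpM2l// lerD2r.
have : (M + 1) * c * 4 = e by rewrite /c; field; rewrite gt_eqF// ltr_wpDl.
by lra.
Qed.

End weak_compactness.

(** * Positive semidefinite kernels *)

Section psd.
Context {R : realType}.
Local Notation RM := (measurableTypeR R).
Local Notation fmeas := {finite_measure set RM -> \bar R}.
Implicit Types (mu nu : Mplus R) (h : R -> R).

Lemma integ_diff_eq (p n m1 m2 : fmeas) h : bmeas h ->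
  (forall A, measurable A -> p A + m2 A = n A + m1 A)%E ->
  integ p h - integ n h = integ m1 h - integ m2 h.
Proof.
move=> bh E.
pose s : {measure set RM -> \bar R} := measure_add p m2.
have sE A : s A = (p A + m2 A)%E by exact: measure_addE.
have sfin : fin_num_fun s by move=> A mA; rewrite sE fin_numD !fin_num_measure.
have H1 : integ (pack_fin_measure sfin) h = integ p h + 1 * integ m2 h.
  by apply: integ_add_measure => // A mA _; rewrite mul1e; exact: sE.
have H2 : integ (pack_fin_measure sfin) h = integ n h + 1 * integ m1 h.
  by apply: integ_add_measure => // A mA _; rewrite mul1e -E//; exact: sE.
by move: H1; rewrite H2; lra.
Qed.

(** The hypothesis on the kernel, for the signed measure mu - nu.  The parts
of its Jordan decomposition are not mu and nu, but differ from them by a common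
measure, which cancels in integrals. *)
Lemma psd_Mplus C q mu nu : kernel_bound C q -> psd_kernel q ->
  0 <= integ mu (fun y => pot q mu y - pot q nu y)
     - integ nu (fun y => pot q mu y - pot q nu y).
Proof.
move=> qC psd.
pose s : {charge set RM -> \bar R} :=
  cadd (charge_of_finite_measure mu) (cscale (-1) (charge_of_finite_measure nu)).
have sE A : s A = (mu A + (-1)%:E * nu A)%E by [].
have s0 A : measurable A -> A `<=` ~` I11 -> s A = 0%E.
  move=> mA AI; rewrite sE.
  have zero (rho : Mplus R) : rho A = 0%E.
    rewrite Mplus_cover// (_ : A `&` I11 = set0) ?measure0//.
    by apply/seteqP; split => // x [/AI].
  by rewrite !zero mule0 adde0.
have [P [N sPN]] := Hahn_decomposition s.
have cE h : bmeas h -> charge_int sPN h = integ mu h - integ nu h.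
  move=> bh; apply: (@integ_diff_eq (jordan_pos sPN) (jordan_neg sPN)) => // A mA.
  have E : (mu A + (-1)%:E * nu A = jordan_pos sPN A + (-1)%:E * jordan_neg sPN A)%E.
    by have := jordan_decomp sPN mA; rewrite sE /cadd => ->.
  have f1 := fin_num_measure mu _ mA; have f2 := fin_num_measure nu _ mA.
  have f3 := fin_num_measure (jordan_pos sPN) _ mA.
  have f4 := fin_num_measure (jordan_neg sPN) _ mA.
  move: E; rewrite -(fineK f1) -(fineK f2) -(fineK f3) -(fineK f4).
  rewrite -!EFinM -!EFinD => -[E].
  have : ((fine (jordan_pos sPN A))%:E + (fine (nu A))%:E =
      (fine (jordan_neg sPN A))%:E + (fine (mu A))%:E)%E.
    by rewrite -!EFinD; congr EFin; lra.
  by rewrite (fineK f3) (fineK f4).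
have := psd s s0 P N sPN.
have qE y : I11 y -> charge_int sPN (fun x => q (x * y)) = pot q mu y - pot q nu y.
  move=> Iy; under [X in charge_int _ X]eq_fun do rewrite mulrC.
  by rewrite cE//; exact: kernel_slice_bmeas qC _ Iy.
have bq : bmeas (fun y => pot q mu y - pot q nu y).
  by apply: bmeasB; exact: pot_bmeas qC _.
rewrite -(cE _ bq).
have eqc k1 k2 : (forall y, I11 y -> k1 y = k2 y) -> charge_int sPN k1 = charge_int sPN k2.
  by move=> e; congr (_ - _); apply: eq_Rintegral => y /set_mem /e.
by rewrite (eqc _ _ qE).
Qed.

(** Split x into its positive and its negative part. *)
Lemma kmatrix_psd C q K (x : 'cV[R]_(2 ^ K.+1)) : kernel_bound C q -> psd_kernel q ->
  0 <= dot x (kmatrix K q *m x).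
Proof.
move=> qC psd; pose u : 'cV[R]_(2 ^ K.+1) := \col_k Num.max (x k 0) 0.
pose w : 'cV[R]_(2 ^ K.+1) := \col_k Num.max (- x k 0) 0.
have u0 : nonneg u by move=> k; rewrite mxE max0_ge0.
have w0 : nonneg w by move=> k; rewrite mxE max0_ge0.
have xE : x = u + (-1) *: w.
  apply/matrixP => i j; rewrite !mxE ord1.
  by have [|] := leP (x i 0) 0; have [|] := leP (- x i 0) 0; lra.
have := psd_Mplus (atomic u) (atomic w) qC psd.
have bp z := pot_bmeas qC (atomic (K := K) z).
rewrite !integB// !(integ_pot_atomic qC)// => h.
by rewrite {1 2}xE mulmxDr -scalemxAr !(dotDl, dotDr, dotZl, dotZr); lra.
Qed.

Lemma close_translate e1 e2 (t : {nonneg R}) mu mu' nu nu' :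
  close e1 mu mu' -> close e2 nu nu' ->
  close (e1 + t%:num * e2) (translate mu t nu) (translate mu' t nu').
Proof.
move=> c1 c2 h hL hB; have bh := lip_on_bmeas hL.
rewrite !integ_translate//.
have -> : forall p1 p2 p3 p4 : R, p1 + t%:num * p2 - (p3 + t%:num * p4) =
  (p1 - p3) + t%:num * (p2 - p4) by move=> *; ring.
rewrite (le_trans (ler_normD _ _))// lerD ?c1// normrM ger0_norm//.
by rewrite ler_wpM2l// c2.
Qed.

(** The law of a constant function. *)
Lemma dirac_exists y : I11 y -> exists nu : Mplus R, forall h, bmeas h -> integ nu h = h y.
Proof.
move=> Iy; have [nu nuE] := @law_exists R (cst y) (fun _ _ _ => lexx _) (fun=> Iy).
exists nu => h bh; rewrite nuE// (_ : h \o cst y = cst (h y))//.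
by rewrite integ_cst tot_unif mulr1.
Qed.

End psd.

(** * The variational formula for a positive kernel *)

Section positive_kernel.
Context {R : realType}.
Implicit Types (mu nu rho : Mplus R).
Variables (psi : Mplus R -> R) (D : Mplus R -> R -> R) (q : R -> R) (L C m a : R).
Hypotheses (L0 : 0 < L) (psiL : lipschitz_TV psi L).
Hypothesis psiD : forall mu, gateaux_density psi mu (D mu).
Hypothesis D_pot : forall mu, exists2 eta : Mplus R, tot eta = a &
  forall x, I11 x -> D mu x = pot q eta x.
Hypotheses (qC : kernel_bound C q) (m0 : 0 < m) (qm : forall x, I11 x -> m <= q x).
Hypotheses (q_psd : psd_kernel q) (a0 : 0 < a).

Let C0 : 0 <= C. Proof. by case: qC. Qed.

(** The derivatives of psi are potentials of measures of mass a, so they have the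
Lipschitz constant and the bound C a. *)
Lemma psi_close e rho nu : close e rho nu -> `|psi rho - psi nu| <= C * a * e.
Proof.
move=> cl; apply: (gateaux_mean_value psiL psiD) => mu.
have [eta etaa DE] := D_pot mu.
rewrite (eq_integ rho DE) (eq_integ nu DE) -etaa; apply: closeP => //.
- by rewrite mulr_ge0// tot_ge0.
- exact: pot_lip.
- by move=> x; exact: pot_bound.
Qed.

Variables (t : R) (t0 : 0 < t).
Let t' : {nonneg R} := NngNum (ltW t0).

Definition payoff mu nu : R := psi (translate mu t' nu) - t / 2 * energy q nu.

Lemma payoff_close e1 e2 mu mu' nu nu' : close e1 mu mu' -> close e2 nu nu' ->
  `|payoff mu nu - payoff mu' nu'| <=
    C * a * (e1 + t * e2) + t / 2 * (C * e2 * (tot nu + tot nu')).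
Proof.
move=> c1 c2; have h1 := psi_close (close_translate t' c1 c2).
have h2 := energy_close qC c2.
rewrite /payoff (_ : _ - _ = (psi (translate mu t' nu) - psi (translate mu' t' nu'))
   - t / 2 * (energy q nu - energy q nu')); last by ring.
rewrite (le_trans (ler_normB _ _))// lerD// normrM gtr0_norm ?divr_gt0//.
by rewrite ler_wpM2l// divr_ge0// ltW.
Qed.

Lemma payoff_atomic K (x z : 'cV[R]_(2 ^ K.+1)) : nonneg x -> nonneg z ->
  payoff (atomic x) (atomic z) = restr_fun psi (x + t *: z) - t * En q z.
Proof.
move=> x0 z0; rewrite /payoff /energy (integ_pot_atomic qC)//; congr (_ - _).
  by apply: lipschitz_TV_ext psiL _ => A mA _; exact: atomic_translate.
by rewrite /En; field.
Qed.

Section optimality.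
Variables (M : R) (mu nus : Mplus R).
Hypotheses (M_ge : a * C < m * M) (nusM : tot nus <= M).
Hypothesis nus_max : forall nu, tot nu <= M -> payoff mu nu <= payoff mu nus.

(** Comparing the payoff at nus with that at nus + s e sigma for small e > 0; the
linear term is t s times the difference of the two integrals.  Here c stands for
the integral of the potential of nus against sigma.  The sign s allows to shrink
nus as well as to enlarge it. *)
Lemma first_variation (eta sigma : Mplus R) (s c e2 r0 : R) : s ^+ 2 = 1 ->
  (forall x, I11 x -> D (translate mu t' nus) x = pot q eta x) -> 0 < r0 ->
  (forall e, 0 < e -> e < r0 -> exists nu : Mplus R, [/\ tot nu <= M,
     forall A, measurable A -> (nu A = nus A + (s * e)%:E * sigma A)%E &
     energy q nu = energy q nus + 2 * (s * e) * c + e ^+ 2 * e2]) ->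
  s * integ sigma (pot q eta) <= s * c.
Proof.
move=> s2 DE r00 H; set l := integ sigma (pot q eta).
have [_ _ /(_ sigma) Dg] := psiD (translate mu t' nus).
have {}Dg : gateaux psi (translate mu t' nus) sigma l.
  by rewrite /l -(eq_integ sigma DE).
have sn : `|s| = 1.
  by apply/eqP; rewrite -(@eqrXn2 _ 2)// ?normr_ge0// real_normK ?num_real// s2 expr1n.
apply/ler_addgt0Pr => k k0.
have k4 : 0 < k / 2 by rewrite divr_gt0.
have [h0 h00 Hg] := gateaux_near Dg k4.
have e20 : 0 < `|e2| + 1 by rewrite ltr_wpDl.
pose e := Num.min (r0 / 2) (Num.min (h0 / (2 * t)) (k / (`|e2| + 1))).
have e0 : 0 < e by rewrite !lt_min !divr_gt0// mulr_gt0.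
have er : e < r0 by rewrite (@le_lt_trans _ _ (r0 / 2))// ?ge_min ?lexx//; lra.
have eh : e * t < h0.
  have : e <= h0 / (2 * t) by rewrite /e !ge_min lexx !orbT.
  rewrite ler_pdivlMr ?mulr_gt0//; lra.
have ek : e * (`|e2| + 1) <= k.
  by rewrite -ler_pdivlMr// /e !ge_min lexx !orbT.
have [nu [nuM nuE nuen]] := H e e0 er.
have := nus_max nuM; rewrite /payoff nuen.
have te0 : 0 < e * t by rewrite mulr_gt0.
have s0 : s != 0 by rewrite -normr_gt0 sn.
have ste : s * (e * t) != 0 by rewrite mulf_neq0// gt_eqF.
have := Hg (s * (e * t)) (translate mu t' nu); rewrite ste.
rewrite normrM sn mul1r gtr0_norm// => /(_ isT eh).
have /[swap]/[apply] : forall A, measurable A -> (translate mu t' nu A =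
    translate mu t' nus A + (s * (e * t))%:E * sigma A)%E.
  move=> A mA; rewrite !translateE nuE//=.
  have f1 := fin_num_measure mu _ mA; have f2 := fin_num_measure nus _ mA.
  have f3 := fin_num_measure sigma _ mA.
  rewrite -(fineK f1) -(fineK f2) -(fineK f3) -?EFinM -?EFinD -?EFinM -?EFinD -?EFinM -?EFinD.
  by congr EFin; ring.
rewrite ler_norml => /andP[h1 _] h2.
have h3 : e * t * (s * l - s * c - k / 2 - e * e2 / 2) <= 0 by lra.
have {h3} : s * l - s * c - k / 2 - e * e2 / 2 <= 0 by rewrite -(pmulr_rle0 _ te0).
have := ler_norm e2; have := ler_wpM2l (ltW e0) (ler_norm e2); lra.
Qed.

(** Variations of nus along itself and along Dirac masses give
integ nus (pot q eta) = energy q nus and pot q eta <= pot q nus.  Therefore the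
energy of eta - nus is at most 0.  Positive semidefiniteness of q at
eta - nus + e delta_y for small e then yields pot q eta y >= pot q nus y, and
the value at y = 0 compares the masses. *)
Lemma optimal : tot nus = a /\
  forall x, I11 x -> pot q nus x = D (translate mu t' nus) x.
Proof.
have [eta etaa DE] := D_pot (translate mu t' nus).
have bp rho : bmeas (pot q rho) by exact: pot_bmeas qC _.
have aCM : 0 < M by rewrite -(pmulr_rgt0 _ m0) (le_lt_trans _ M_ge)// mulr_ge0// ltW.
have scaled (c : R) : 0 <= c -> energy q (comb c 0 nus nus) = c ^+ 2 * energy q nus /\
    tot (comb c 0 nus nus) = c * tot nus.
  move=> c0; have iE h : bmeas h -> integ (comb c 0 nus nus) h = c * integ nus h.
    by move=> bh; rewrite integ_comb// (max_idPl c0) maxxx mul0r addr0.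
  split; last by have := iE _ (bmeas_cst 1); rewrite !integ_cst !mul1r.
  rewrite /energy iE//.
  rewrite (eq_integ nus (k := fun x => c * pot q nus x)).
    by rewrite integZ// expr2 mulrA.
  by move=> x Ix; rewrite /pot iE//; exact: kernel_slice_bmeas qC _ Ix.
have scaledE (c s e : R) (A : set (measurableTypeR R)) : measurable A -> 0 <= c -> c = 1 + s * e ->
    (comb c 0 nus nus A = nus A + (s * e)%:E * nus A)%E.
  move=> mA + cE; rewrite cE => c0.
  rewrite combE -(fineK (fin_num_measure nus _ mA)) (max_idPl c0).
  by rewrite maxxx -!EFinM -!EFinD; congr EFin; ring.
set T := tot nus; have T0 : 0 <= T by exact: tot_ge0.
have lE : energy q nus <= integ nus (pot q eta).
  suff : -1 * integ nus (pot q eta) <= -1 * energy q nus by lra.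
  apply: (@first_variation eta nus (-1) (energy q nus) (energy q nus) 1) => //.
    by rewrite sqrrN expr1n.
  move=> e e0 e1; have c0 : 0 <= 1 - e by lra.
  have [sE sT] := scaled _ c0.
  exists (comb (1 - e) 0 nus nus); split.
  - by rewrite sT (le_trans _ nusM)// ler_piMl//; lra.
  - by move=> A mA; apply: scaledE => //; ring.
  - by rewrite sE; ring.
(* As q >= m, the energy controls the square of the mass.  With the upper bound
   a C T on the other side, the constraint on the mass is not active. *)
have enT : m * T ^+ 2 <= energy q nus.
  have mT x : I11 x -> m * T <= pot q nus x.
    move=> Ix; rewrite -integ_cst; apply: ler_integ.
    - exact: bmeas_cst.
    - exact: kernel_slice_bmeas qC _ Ix.
    - by move=> y Iy; apply: qm; exact: I11M.
  rewrite expr2 mulrA -integ_cst; apply: ler_integ => //; exact: bmeas_cst.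
have TM : T < M.
  have [->//|Tn0] := eqVneq T 0.
  have T_gt0 : 0 < T by rewrite lt_neqAle eq_sym Tn0.
  have : m * T ^+ 2 <= a * C * T.
    rewrite (le_trans enT)// (le_trans lE)// (le_trans (ler_norm _))//.
    apply: ler_norm_integ => // x Ix; rewrite mulrC -etaa; exact: pot_bound.
  rewrite expr2 mulrA ler_pM2r// => h.
  by rewrite -(ltr_pM2l m0) (le_lt_trans h).
have T1 : 0 < T + 1 by rewrite ltr_wpDl.
have r1 : 0 < (M - T) / (T + 1) by rewrite divr_gt0 ?subr_gt0.
have El : integ nus (pot q eta) <= energy q nus.
  suff : 1 * integ nus (pot q eta) <= 1 * energy q nus by rewrite !mul1r.
  apply: (@first_variation eta nus 1 (energy q nus) (energy q nus) _ _ _ r1) => //.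
    by rewrite expr1n.
  move=> e e0 er; have c0 : 0 <= 1 + e by lra.
  have [sE sT] := scaled _ c0.
  exists (comb (1 + e) 0 nus nus); split.
  - move: er; rewrite ltr_pdivlMr// => er.
    by rewrite sT -/T; lra.
  - by move=> A mA; apply: scaledE => //; ring.
  - by rewrite sE; ring.
have le_pot y : I11 y -> pot q eta y <= pot q nus y.
  move=> Iy; have [dl dlE] := dirac_exists Iy.
  have dlT : tot dl = 1 by have := dlE _ (bmeas_cst 1); rewrite integ_cst mul1r.
  suff : 1 * integ dl (pot q eta) <= 1 * pot q nus y by rewrite !mul1r dlE.
  have MT : 0 < M - T by rewrite subr_gt0.
  apply: (@first_variation eta dl 1 (pot q nus y) (pot q dl y) _ _ _ MT) => //.
    by rewrite expr1n.
  move=> e e0 eM; exists (translate nus (NngNum (ltW e0)) dl).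
  have pE x : I11 x -> pot q (translate nus (NngNum (ltW e0)) dl) x = pot q nus x + e * pot q dl x.
    by move=> Ix; rewrite /pot integ_translate//; exact: kernel_slice_bmeas qC _ Ix.
  split.
  - by rewrite tot_translate dlT mulr1 /= -/T; lra.
  - by move=> A mA; rewrite translateE mul1r.
  - rewrite /energy (eq_integ _ pE) integ_translate//=; last by apply: bmeasD => //; exact: bmeasZ.
    rewrite !integD//; try exact: bmeasZ.
    rewrite !integZ// !dlE//.
    have -> : integ nus (pot q dl) = pot q nus y.
      apply: eq_integ => x Ix; rewrite /pot dlE; last exact: kernel_slice_bmeas qC _ Ix.
      by rewrite mulrC.
    by rewrite mul1r; ring.
pose f x := pot q eta x - pot q nus x.
have bf : bmeas f by exact: bmeasB.
(* This is the energy of the signed measure eta - nus. *)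
have W : integ eta f - integ nus f <= 0.
  have -> : integ nus f = 0 by rewrite integB//; apply/eqP; rewrite subr_eq0 eq_le El lE.
  rewrite subr0 -(mul0r (tot eta)) -integ_cst; apply: ler_integ => //; first exact: bmeas_cst.
  by move=> x Ix; rewrite subr_le0 le_pot.
have f0 y : I11 y -> pot q eta y = pot q nus y.
  move=> Iy; apply/le_anti; rewrite le_pot//= -subr_ge0.
  have [dl dlE] := dirac_exists Iy.
  suff : - f y <= 0 by rewrite oppr_le0.
  apply: (@first_order_le0 _ 1 _ (pot q dl y / 2)) => // e e0 _.
  pose e' := NngNum (ltW e0); pose mue := translate eta e' dl.
  have pE x : I11 x -> pot q mue x - pot q nus x = f x + e * pot q dl x.
    move=> Ix; rewrite /f /pot integ_translate/=; first by ring.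
    exact: kernel_slice_bmeas qC _ Ix.
  have bed : bmeas (fun x => e * pot q dl x) by exact: bmeasZ.
  have := psd_Mplus mue nus qC q_psd.
  rewrite !(eq_integ _ pE) integ_translate/=; last exact: bmeasD.
  rewrite !(integD _ bf bed) !integZ// !dlE//.
  have slice (rho : Mplus R) : integ rho (pot q dl) = pot q rho y.
    apply: eq_integ => x Ix; rewrite /pot dlE; last exact: kernel_slice_bmeas qC _ Ix.
    by rewrite mulrC.
  by rewrite !slice /f; rewrite /f in W; lra.
have I0 : I11 (0 : R) by rewrite I11E; lra.
have totE : tot nus = a.
  have pot0 rho : pot q rho 0 = q 0 * tot rho.
    by rewrite /pot -integ_cst; apply: eq_integ => x _; rewrite mul0r.
  have q0 : q 0 != 0 by rewrite gt_eqF// (lt_le_trans m0)// qm.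
  by have := f0 0 I0; rewrite !pot0 => /(mulfI q0) <-.
by split => // x Ix; rewrite DE// f0.
Qed.

End optimality.

(** The approximate solutions are Hopf-Lax functions.  Their maximizers
converge weakly along an ultrafilter to some nus, which gives the equality; the
discretizations of any other nu are admissible on every level, which gives the
inequality. *)
Lemma positive_kernel_formula (f : R -> Mplus R -> R) mu : HJ_solution_pos q psi f ->
  exists nus : Mplus R, [/\ tot nus = a, f t mu = payoff mu nus,
    forall nu, tot nu = a -> payoff mu nu <= f t mu &
    forall x, I11 x -> pot q nus x = D (translate mu t' nus) x].
Proof.
move=> fsol.
(* The bound M exceeds L / m, so that the mass constraint is inactive in the
   conjugate of Hfun; a C / m, so that it is inactive at the maximizer of the
   payoff; and a, so that all measures of mass a compete. *)
pose M := (a * C + L) / m + a + 1.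
have Mm : m * M = a * C + L + m * a + m by rewrite /M; field; rewrite gt_eqF.
have aC0 : 0 <= a * C by rewrite mulr_ge0// ltW.
have ma0 : 0 < m * a by rewrite mulr_gt0.
have M0 : 0 <= M.
  by rewrite /M !addr_ge0// ?divr_ge0 ?addr_ge0// ltW.
have aM : a <= M.
  have : 0 <= (a * C + L) / m by rewrite divr_ge0 ?addr_ge0// ltW.
  by rewrite /M; lra.
clearbody M.
(* Large enough for the truncation at r to be invisible to the maximizers. *)
pose r := C * M + m * M + L + 1.
have CM0 : 0 <= C * M by rewrite mulr_ge0.
have mM0 : 0 <= m * M by rewrite mulr_ge0// ltW.
have Lr : (Lip_TV psi < r%:E)%E.
  rewrite (@le_lt_trans _ _ L%:E)//; first by apply: ereal_inf_lbound; exists L.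
  by rewrite lte_fin /r; have := L0; lra.
have qm' z : z \in I11 -> m <= q z by move=> /set_mem; exact: qm.
have [u [uniq ucvg]] := fsol m r m0 qm' Lr.
have LM : L < m * M by rewrite Mm; have := m0; lra.
have Mr : m * M <= 4 * r by rewrite /r; have := L0; lra.
have CMr : C * M <= r by rewrite /r; have := L0; lra.
have uE K (x : 'cV[R]_(2 ^ K.+1)) : (0 < K)%N -> nonneg x ->
    u K t x = hopf (restr_fun psi) (En q) M t x.
  move=> K0 x0; have [_ /(_ (hopf (restr_fun psi) (En q) M)) ->//] := uniq K K0; last exact: ltW.
  have Qp := kmatrix_psd (K := K) _ qC q_psd.
  apply: (hopf_solution (ltW L0) M0).
  - exact: restr_fun_lip (ltW L0) psiL.
  - exact: En_cont.
  - by move=> z w s _ _; exact: En_convex.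
  - by move=> y z; exact: (Hfun_ge qC m0 qm Qp (ltW L0) LM Mr CMr).
  - by move=> y; exact: (Hfun_le qC m0 qm Qp (ltW L0) LM Mr CMr).
pose X K := coords K mu.
have X0 K : nonneg (X K) by exact: coords_nonneg.
have zex K : exists z : 'cV[R]_(2 ^ K.+1), ball_pos M z /\
    hopf (restr_fun psi) (En q) M t (X K) = payoff (atomic (X K)) (atomic z).
  have [z [Mz -> _]] := hopf_max (En := En q) (ltW L0) M0 (restr_fun_lip (ltW L0) psiL)
    (En_cont (q := q) (K := K)) t (X K).
  by exists z; split => //; rewrite payoff_atomic//; case: Mz.
pose z K := sval (cid (zex K)).
have zP K : ball_pos M (z K) /\
    hopf (restr_fun psi) (En q) M t (X K) = payoff (atomic (X K)) (atomic (z K)).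
  exact: svalP (cid (zex K)).
clearbody z.
have [U [PU oU [nus nusP]]] := weak_compact (fun K => (zP K).1).
have ucvgU : u K t (X K) @[K --> U] --> f t mu.
  by move=> B /(ucvg t mu (ltW t0)) BK; exact: oU.
have pos_near : \forall K \near \oo, (0 < K)%N by exists 1%N.
have nusM : tot nus <= M.
  apply/ler_addgt0Pr => e e0; have [K hK] := @filter_ex _ _ PU _ (nusP e e0).
  have [[z0 zM] _] := zP K.
  by have := close_tot hK; rewrite tot_atomic// ler_norml => /andP[h _]; lra.
have B0 : 0 <= C * a * (tot mu + t) + t / 2 * (C * (M + M)).
  have a_ge0 := ltW a0; have t_ge0 := ltW t0.
  have T0 := tot_ge0 mu.
  by apply: addr_ge0; do ![apply: divr_ge0|apply: mulr_ge0|apply: addr_ge0].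
have bound (e : R) K (y : Mplus R) nu : 0 < e -> (2 ^+ K)^-1 <= e -> tot y <= M -> tot nu <= M ->
    close e y nu ->
    `|payoff (atomic (X K)) y - payoff mu nu| <=
      (C * a * (tot mu + t) + t / 2 * (C * (M + M))) * e.
  move=> e0 Ke yM nuM yn.
  rewrite (le_trans (payoff_close (coords_close K mu) yn))//.
  have h1 : C * a * ((2 ^+ K)^-1 * tot mu + t * e) <= C * a * (e * tot mu + t * e).
    by rewrite ler_wpM2l ?mulr_ge0 ?(ltW a0)// lerD2r ler_wpM2r// tot_ge0.
  have h2 : t / 2 * (C * e * (tot y + tot nu)) <= t / 2 * (C * e * (M + M)).
    rewrite ler_wpM2l ?divr_ge0 ?(ltW t0)// ler_wpM2l ?mulr_ge0 ?(ltW e0)// lerD//.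
  by lra.
have fE : f t mu = payoff mu nus.
  apply/eqP; rewrite -subr_eq0 -normr_le0; apply: (eps_le0 (addr_ge0 B0 ler01)) => e e0.
  have n1 : \forall K \near U, `|f t mu - u K t (X K)| <= e by exact: cvgr_dist_le ucvgU _ e0.
  have n2 := oU _ (pow2_small e0); have n3 := oU _ pos_near.
  have [K [[h1 h2] [h3 h4]]] := @filter_ex _ _ PU _ (filterI (filterI n1 n2) (filterI n3 (nusP e e0))).
  have [[z0 zM] zE] := zP K.
  have := bound e K _ nus e0 h2 _ nusM h4; rewrite tot_atomic// => /(_ zM).
  rewrite -zE -uE// => h5.
  rewrite (_ : f t mu - _ = (f t mu - u K t (X K)) + (u K t (X K) - payoff mu nus)); last by ring.
  by rewrite (le_trans (ler_normD _ _))// mulrDl mul1r addrC lerD.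
have f_ge nu : tot nu <= M -> payoff mu nu <= f t mu.
  move=> nuM; rewrite -subr_le0.
  have T0 := tot_ge0 nu.
  apply: (eps_le0 (B := (C * a * (tot mu + t) + t / 2 * (C * (M + M))) * (tot nu + 1) + 1)).
    by rewrite addr_ge0// mulr_ge0// addr_ge0.
  move=> e e0.
  have n1 : \forall K \near \oo, `|f t mu - u K t (X K)| <= e.
    exact: cvgr_dist_le (ucvg t mu (ltW t0)) _ e0.
  have [K [[h1 h2] h3]] := @filter_ex _ \oo _ _ (filterI (filterI n1 (pow2_small e0)) pos_near).
  have e1 : 0 < e * (tot nu + 1) by rewrite mulr_gt0// ltr_wpDl.
  have h2' : (2 ^+ K)^-1 <= e * (tot nu + 1).
    by rewrite (le_trans h2)// ler_peMr ?(ltW e0)// lerDr.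
  have cl : close (e * (tot nu + 1)) (atomic (coords K nu)) nu.
    move=> h hL hB; rewrite (le_trans (coords_close K nu hL hB))//.
    by rewrite ler_pM ?invr_ge0 ?exprn_ge0// lerDl.
  have cM : tot (atomic (coords K nu)) <= M by rewrite tot_coords.
  have := bound _ K _ nu e1 h2' cM nuM cl; rewrite ler_norml => /andP[h5 _].
  have c0 := coords_nonneg (K := K) nu.
  have Mc : ball_pos M (coords K nu) by split => //; rewrite norm1_coords.
  have := hopf_ge (En := En q) (ltW L0) M0 (restr_fun_lip (ltW L0) psiL)
    (En_cont (q := q) (K := K)) t (X K) Mc.
  rewrite -uE// -payoff_atomic// => h6.
  move: h1; rewrite ler_norml => /andP[h1 h1'].
  by lra.
have nus_max nu : tot nu <= M -> payoff mu nu <= payoff mu nus.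
  by move=> nuM; rewrite -fE f_ge.
have aCmM : a * C < m * M by rewrite Mm; have := m0; have := L0; lra.
have [ta Hx] := optimal aCmM nusM nus_max.
by exists nus; split => // nu nua; apply: f_ge; rewrite nua.
Qed.

End positive_kernel.

(** * Translated kernels and the main theorem *)

Section translated_kernel.
Context {R : realType}.
Implicit Types (mu nu : Mplus R) (g : R -> R).

Lemma pot_shift C g b mu x : kernel_bound C g -> I11 x ->
  pot (fun z => g z + b) mu x = pot g mu x + b * tot mu.
Proof.
move=> gC Ix; rewrite /pot integD ?integ_cst//; last exact: bmeas_cst.
exact: kernel_slice_bmeas gC _ Ix.
Qed.

Lemma energy_shift C g b mu : kernel_bound C g ->
  energy (fun z => g z + b) mu = energy g mu + b * tot mu ^+ 2.
Proof.
move=> gC; rewrite /energy (eq_integ mu (k := fun x => pot g mu x + cst (b * tot mu) x)).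
  rewrite integD ?integ_cst//; last exact: bmeas_cst.
    by rewrite expr2 mulrA.
  exact: pot_bmeas gC _.
by move=> x Ix; rewrite (pot_shift _ _ gC Ix).
Qed.

(** The mass is linear, so its difference quotients are constant. *)
Lemma gateaux_density_mass (psi : Mplus R -> R) mu (D : R -> R) c :
  gateaux_density psi mu D ->
  gateaux_density (fun nu => psi nu + c * mass nu) mu (fun x => D x + c).
Proof.
move=> [mD [M hM] Dg].
have bD : bmeas D by split => //; exists M => x Ix; apply: hM; exact: mem_set.
have [m2 [M2 hM2]] := bmeasD bD (bmeas_cst c).
split => //; first by exists M2 => x /set_mem; exact: hM2.
move=> nu e e0; apply: filterS2 (Dg nu e e0) (@nbhs_dnbhs_neq R 0) => h H h0 rho rhoE.
have := H rho rhoE.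
have -> : \int[nu]_(x in I11) (D x + c) = \int[nu]_(x in I11) D x + c * tot nu.
  by rewrite -integ_cst -[RHS](integD nu bD (bmeas_cst c)).
have -> : mass rho = mass mu + h * tot nu.
  rewrite /mass rhoE; last exact: measurable_I11.
  by rewrite fineD ?fineM ?fin_numM// fin_num_measure//; exact: measurable_I11.
congr (`|_| < e); field; exact: h0.
Qed.

Lemma lipschitz_TV_mass (psi : Mplus R -> R) L c : lipschitz_TV psi L ->
  lipschitz_TV (fun nu => psi nu + c * mass nu) (L + `|c|).
Proof.
move=> psiL mu nu; rewrite opprD addrACA -mulrBr (le_trans (ler_normD _ _))//.
rewrite mulrDl lerD ?psiL// normrM ler_wpM2l//.
by have := mass_lipschitz_TV mu nu; rewrite mul1r.
Qed.

End translated_kernel.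

Theorem theorem1p5 (R : realType) (g : R -> R) (psi : Mplus R -> R) (a : R)
    (Dpsi : Mplus R -> R -> R) (f : R -> Mplus R -> R)
  (g_C1 : C1_on_I11 g)
  (H2 : exists L : R, lipschitz_TV psi L)
  (a_gt0 : 0 < a)
  (H3' : forall K : nat, (0 < K)%N ->
     gradient_in_Kset' g a (restr_fun (K := K) psi))
  (H4 : exists L : R, lipschitz_W psi L)
  (g_pos : exists b : R,
     (forall z, z \in I11 -> 0 < g z + b) /\ psd_kernel (fun z => g z + b))
  (Dpsi_density : forall mu : Mplus R, gateaux_density psi mu (Dpsi mu))
  (Dpsi_Cinfty : forall mu : Mplus R, in_Cinfty g a (Dpsi mu))
  (f_sol : HJ_solution g psi a f) :
  forall (t : R) (t_gt0 : 0 < t) (mu : Mplus R),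
    let t' : {nonneg R} := NngNum (ltW t_gt0) in
    let s : \bar R :=
      ereal_sup [set (psi (translate mu t' nu)
                      - t / 2 * \int[nu]_(y in I11) Gfun g nu y)%:E
                | nu in [set nu : Mplus R | mass nu = a]] in
    (f t mu)%:E = s /\
    exists nu' : Mplus R,
      [/\ mass nu' = a,
          (psi (translate mu t' nu')
           - t / 2 * \int[nu']_(y in I11) Gfun g nu' y)%:E = s &
          forall x, x \in I11 ->
            Gfun g nu' x = Dpsi (translate mu t' nu') x].
Proof.
move=> t t_gt0 mu t' s.
have [L L0 psiL] := lipschitz_TV_gt0 H2.
have [b [gb_pos gb_psd]] := g_pos.
have [C [gC qC]] := C1_kernel_bound b g_C1.
set q := fun z => g z + b in gb_psd qC.
have [m m0 qm] : exists2 m, 0 < m & forall x, I11 x -> m <= q x.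
  by case: qC => _ qL _; apply: lip_on_min qL _ => x /mem_set; exact: gb_pos.
have [fb fb_sol fE] := f_sol b gb_pos.
have D_pot nu : exists2 eta : Mplus R, tot eta = a &
    forall x, I11 x -> Dpsi nu x + a * b = pot q eta x.
  have [eta eta_a etaD] := Dpsi_Cinfty nu; exists eta => // x Ix.
  rewrite (pot_shift b eta gC Ix) [tot eta]eta_a etaD; last exact: mem_set.
  by rewrite mulrC.
have Lb : 0 < L + `|a * b| by rewrite ltr_wpDr.
have [nus [nus_a fbE fb_ge nusD]] := positive_kernel_formula Lb
  (lipschitz_TV_mass (a * b) psiL) (fun nu => gateaux_density_mass (a * b) (Dpsi_density nu))
  D_pot qC m0 qm gb_psd a_gt0 t_gt0 mu fb_sol.
pose J (nu : Mplus R) := psi (translate mu t' nu) - t / 2 * energy g nu.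
have JE (nu : Mplus R) : tot nu = a -> payoff (fun nu => psi nu + a * b * mass nu) q t_gt0 mu nu
    - a * b * mass mu - a ^+ 2 * b * t / 2 = J nu.
  move=> nua; rewrite /payoff (energy_shift b nu gC) nua.
  have -> : mass (translate mu t' nu) = mass mu + t * a.
    by have := tot_translate mu t' nu; rewrite nua.
  by rewrite /J; field.
have fJ : f t mu = J nus by rewrite (fE _ _ (ltW t_gt0)) fbE JE.
have J_le (nu : Mplus R) : mass nu = a -> J nu <= f t mu.
  by move=> nua; rewrite -(JE _ nua) (fE _ _ (ltW t_gt0)) !lerD2r; exact: fb_ge.
have sE : (f t mu)%:E = s.
  apply/le_anti/andP; split; first by rewrite fJ; apply: ereal_sup_ubound; exists nus.
  by apply: ge_ereal_sup => _ [nu nua <-]; rewrite lee_fin; exact: J_le.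
split=> //; exists nus; split=> //; first by rewrite -sE fJ.
move=> x /set_mem Ix; have := nusD x Ix.
rewrite (pot_shift b nus gC Ix) nus_a mulrC => /addIr.
exact.
Qed.
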